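(* Let $D$ be an oriented virtual knotoid diagram and let $$\mathcal{F}(D)=\sum_{c}\operatorname{sgn}(c)\,[\overline{D_c}]-w(D)\,[\overline{D}]$$ be its $0$-smoothing polynomial, where the sum runs over all classical crossings $c$ of $D$ and $w(D)=\sum_c\operatorname{sgn}(c)$. Then $\mathcal{F}(D)$ is a virtual knotoid invariant; that is, if $D$ and $E$ are equivalent virtual knotoid diagrams, then $\mathcal{F}(D)=\mathcal{F}(E)$ in the free $\mathbb{Z}$-module generated by the non-oriented flat virtual knotoids.
   Context: Virtual knotoid diagrams. A virtual knotoid diagram is a generic immersion of $[0,1]$ into the oriented sphere $S^2$ with finitely many transversal double points, each of which is either a classical crossing (with over/under information) or a virtual crossing (no such information). The images of $0$ and $1$ (tail and head) are distinct from each other and from all crossings; the diagram is oriented from tail to head. Two virtual knotoid diagrams are equivalent if they are related by a finite sequence of isotopies of $S^2$ and the following local moves (with all orientations), performed in disks away from the endpoints unless stated otherwise: the classical Reidemeister moves $\Omega_1,\Omega_2,\Omega_3$; the virtual Reidemeister moves $\Omega_1^v,\Omega_2^v,\Omega_3^v$ (the same moves with all crossings virtual); the mixed move $\Omega_3^m$ (an arc having two consecutive virtual crossings is moved across a classical crossing); and the move $\Omega_v$ (the tail or head is slid across a strand, creating or deleting a virtual crossing). Moving an endpoint across a strand so as to create or delete a classical crossing is not allowed. A virtual knotoid is an equivalence class. Flat virtual knotoids. A flat virtual knotoid diagram is obtained by forgetting the over/under information at every classical crossing (which becomes a flat crossing); virtual crossings remain. Flat equivalence is generated by isotopy of $S^2$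 and the flat versions of all the moves above. Moving an endpoint across a strand so as to create or delete a flat crossing is not allowed, nor is moving an arc having two consecutive flat crossings across a virtual crossing. In the non-oriented version the orientation is forgotten (so the two endpoints are not distinguished). A non-oriented flat virtual knotoid is an equivalence class of non-oriented flat virtual knotoid diagrams; $[\,\cdot\,]$ denotes this class. $\overline{D}$ denotes the non-oriented flattening of $D$. Sign. For a classical crossing $c$, $\operatorname{sgn}(c)=+1$ if (direction of over-strand, direction of under-strand) is a positively oriented basis, and $-1$ otherwise. $0$-smoothing. For a classical crossing $c$ of $D$, the $0$-smoothing at $c$ (smoothing against orientation) removes the crossing and joins the two incoming strand ends to each other and the two outgoing strand ends to each other. The result $D_c$ is again a virtual knotoid diagram (a single segment), and $\overline{D_c}$ is its non-oriented flattening. *)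

(* Defs.v *)
From HB Require Import structures.
From mathcomp Require Import all_boot all_algebra.
From mathcomp Require Import boolp.
From mathcomp.multinomials Require Import freeg.
From Stdlib Require Import Relation_Operators.

Set Implicit Arguments.
Unset Strict Implicit.
Unset Printing Implicit Defensive.

Import GRing.Theory.
Local Open Scope ring_scope.
Local Open Scope quotient_scope.

(* A generic immersion of [0,1] into the oriented sphere, with classical, flat
   and virtual double points, is recorded by the word of the passages through
   its double points, read from tail to head.  As the image is connected, its
   complementary regions are discs, so this word determines the diagram up to
   isotopy of the oriented sphere and renaming of the double points; virtual
   crossings are kept as genuine double points, and `planar` below says that
   the word is realised on the sphere.                                        *)

Inductive kind := Over | Under | Flat | Virtual.

Definition kind_code (k : kind) : bool * bool :=
  match k with
  | Over => (true, true) | Under => (true, false)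
  | Flat => (false, true) | Virtual => (false, false)
  end.
Definition kind_decode (b : bool * bool) : kind :=
  match b with
  | (true, true) => Over | (true, false) => Under
  | (false, true) => Flat | (false, false) => Virtual
  end.
Lemma kind_codeK : cancel kind_code kind_decode.
Proof. by case. Qed.
HB.instance Definition _ := Choice.copy kind (can_type kind_codeK).

(* A passage: the name of the double point, the kind of the passing strand
   there, and a boolean which is true iff (direction of this strand, direction
   of the other strand) is a positively oriented basis.                       *)
Definition letter : Type := nat * kind * bool.
Definition word : Type := seq letter.

Definition lab (x : letter) : nat := x.1.1.
Definition knd (x : letter) : kind := x.1.2.
Definition pos (x : letter) : bool := x.2.
Definition is_virtual (x : letter) : bool := knd x == Virtual.

Definition opp_kind (k : kind) : kind :=
  match k with
  | Over => Under | Under => Over | Flat => Flat | Virtual => Virtual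
  end.

(* The other passage through the same double point. *)
Definition opp (x : letter) : letter := (lab x, opp_kind (knd x), ~~ pos x).

Definition gauss_word (w : word) : bool :=
  uniq [seq (lab x, pos x) | x <- w] && all (fun x => opp x \in w) w.

(* The edges are numbered 0, ..., size w, edge i ending at letter i (the last
   one at the head); an edge traversed forwards (true) or backwards is a dart.
   From a dart one continues with the next dart around the region on its left:
   turn left at a double point, turn back at an endpoint.                     *)
Definition face_step (w : word) (d : 'I_(size w).+1 * bool) :
    'I_(size w).+1 * bool :=
  let: (i, fwd) := d in
  if fwd && (i == size w :> nat) then (i, false)
  else if ~~ fwd && (i == 0%N :> nat) then (i, true)
  else
    let x := nth (0%N, Virtual, true) w (if fwd then i : nat else i.-1) in
    let j := index (opp x) w in
    if pos x == fwd then (inord j.+1, true) else (inord j, false).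
Arguments face_step : clear implicits.

(* With n double points there are n + 2 vertices (the endpoints included) and
   2n + 1 edges, so the Euler characteristic is 2 iff there are n + 1 faces.  *)
Definition planar (w : word) : bool :=
  fcard (face_step w) predT == (size w)./2.+1.

Definition is_diagram (P : pred kind) (w : word) : bool :=
  [&& gauss_word w, planar w & all (fun x => P (knd x)) w].

Record diagram (P : pred kind) :=
  Diagram { word_of :> word; _ : is_diagram P word_of }.
HB.instance Definition _ P := [isSub for @word_of P].
HB.instance Definition _ P := [Choice of diagram P by <:].

Definition virtual_knotoid_diagram := diagram (predC1 Flat).
Definition flat_diagram := diagram (pred2 Flat Virtual).

(* Side of a polygonal face whose boundary, followed with the face on its left,
   goes from the double point of x to that of y; e tells whether the strand
   runs in that direction.                                                    *)
Definition side (e : bool) (x y : letter) : word :=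
  if e then [:: x; y] else [:: y; x].

(* The moves, applied to words of diagrams; one direction of each suffices, as
   the symmetric closure is taken later.
   - move1 removes a monogon: two consecutive passages through the same double
     point always bound an empty disc in a planar diagram.
   - move2 removes a bigon: that the two double points have opposite
     orientation data says that the two edges joining them bound a face, and
     equality of kinds says that both are virtual, or both are flat, or both
     are classical with the same strand on top.
   - move3 slides a strand across a double point.  A triangular face, followed
     with the face on the left, has sides (opp z -> x), (opp x -> y),
     (opp y -> z), each a factor of the word (in any order); it turns left from
     one side to the next exactly when pos is the equality of the two
     directions.  The two letters of each side get exchanged.  The moving strand
     (first side) is over both, under both, flat at both or virtual at both
     other strands; unless it is virtual at both, the double point of those two
     must not be virtual (the forbidden move).
   - move_tail, move_head withdraw an endpoint across a strand through a
     virtual crossing.                                                        *)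
Inductive move : word -> word -> Prop :=
| move1 x p q :
    move (p ++ [:: x; opp x] ++ q) (p ++ q)
| move2 x y b p q r of
    b = [:: opp x; opp y] \/ b = [:: opp y; opp x] &
    knd x = knd y & pos x != pos y :
    move (p ++ [:: x; y] ++ q ++ b ++ r) (p ++ q ++ r)
| move3 x y z (e1 e2 e3 : bool) (b1 b2 b3 p q r s : word) of
    perm_eq [:: b1; b2; b3]
      [:: side e1 (opp z) x; side e2 (opp x) y; side e3 (opp y) z] &
    pos x = (e1 == e2) & pos y = (e2 == e3) & pos z = (e3 == e1) &
    knd x = knd (opp z) & is_virtual x || ~~ is_virtual y :
    move (p ++ b1 ++ q ++ b2 ++ r ++ b3 ++ s)
         (p ++ rev b1 ++ q ++ rev b2 ++ r ++ rev b3 ++ s)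
| move_tail x p q of is_virtual x :
    move (x :: p ++ opp x :: q) (p ++ q)
| move_head x p q of is_virtual x :
    move (p ++ opp x :: q ++ [:: x]) (p ++ q).

Definition isotopic (v w : word) : Prop :=
  exists2 f : nat -> nat,
    injective f & w = [seq (f (lab x), knd x, pos x) | x <- v].

Definition knotoid_equiv :
    virtual_knotoid_diagram -> virtual_knotoid_diagram -> Prop :=
  clos_refl_sym_trans _
    (fun D E : virtual_knotoid_diagram => isotopic D E \/ move D E).

(* Reversing the orientation reverses both directions at every double point, so
   it only reverses the word; a non-oriented diagram is a diagram up to this. *)
Definition flat_equiv : flat_diagram -> flat_diagram -> Prop :=
  clos_refl_sym_trans _
    (fun D E : flat_diagram =>
       [\/ isotopic D E, move D E | word_of E = rev (word_of D)]).

Definition flat_eqb : rel flat_diagram := fun D E => `[< flat_equiv D E >].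

Lemma flat_eqb_refl : reflexive flat_eqb.
Proof. by move=> D; apply/asboolP; apply: rst_refl. Qed.
Lemma flat_eqb_sym : symmetric flat_eqb.
Proof. by move=> D E; apply/asboolP/asboolP; apply: rst_sym. Qed.
Lemma flat_eqb_trans : transitive flat_eqb.
Proof.
move=> E D G /asboolP DE /asboolP EG; apply/asboolP.
exact: rst_trans DE EG.
Qed.
Canonical flat_eqb_equiv :=
  EquivRel flat_eqb flat_eqb_refl flat_eqb_sym flat_eqb_trans.

Definition flat_knotoid := {eq_quot flat_eqb}.

Lemma nil_is_diagram P : is_diagram P [::].
Proof.
have sym : connect_sym (frel (face_step [::])).
  apply: fconnect_sym => -[i b] [j c].
  by rewrite [i]ord1 [j]ord1; case: b; case: c.
rewrite /is_diagram /planar /= andbT; apply/eqP.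
rewrite -[RHS](n_comp_connect sym (ord0, true)).
apply: eq_n_comp_r => -[i b]; rewrite !inE; apply/esym.
rewrite [i]ord1; case: b; first exact: connect0.
exact: (fconnect1 (face_step [::]) (ord0, true)).
Qed.
Definition nil_diagram (P : pred kind) : diagram P :=
  Diagram (nil_is_diagram P).

Definition flatten_kind (k : kind) : kind :=
  if k is Virtual then Virtual else Flat.
Definition flatten_word (w : word) : word :=
  [seq (lab x, flatten_kind (knd x), pos x) | x <- w].

(* The non-oriented flat virtual knotoid of the flattening of w.  The default
   of insubd only serves totality: flattening and 0-smoothing the word of a
   diagram give the word of a diagram.                                        *)
Definition flat_class (w : word) : flat_knotoid :=
  \pi_flat_knotoid (insubd (nil_diagram (pred2 Flat Virtual)) (flatten_word w)).

(* Smoothing against the orientation: in w = p c q c r, q is traversed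
   backwards.  At a double point visited exactly once by q, one of the two
   directions is reversed.                                                    *)
Definition smooth (c : nat) (w : word) : word :=
  let at_c x := lab x == c in
  let i := find at_c w in
  let p := take i w in
  let t := drop i.+1 w in
  let j := find at_c t in
  let q := take j t in
  let r := drop j.+1 t in
  [seq (lab x, knd x, pos x (+) (count_mem (lab x) (map lab q) == 1%N))
     | x <- p ++ rev q ++ r].

Definition classical_crossings (w : word) : seq nat :=
  [seq lab x | x <- w & knd x == Over].

Definition crossing_sign (w : word) (c : nat) : int :=
  if (c, Over, true) \in w then 1 else -1.

Definition writhe (w : word) : int :=
  \sum_(c <- classical_crossings w) crossing_sign w c.

Definition smoothing_polynomial (D : virtual_knotoid_diagram) :
    {freeg flat_knotoid / int} :=
  \sum_(c <- classical_crossings D)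
     << crossing_sign D c *g flat_class (smooth c D) >>
  - << writhe D *g flat_class D >>.

(* Main.v *)
(** A diagram is planar when its Gauss word bounds as many faces as the Euler
    characteristic of the sphere requires.  Smoothing a crossing against the
    orientation glues two opposite corners, so it loses at most one face, and by
    induction on the number of crossings every Gauss word satisfies the Euler
    inequality; hence smoothing preserves planarity.  Likewise a bigon can be
    removed from a planar word.

    The polynomial is the sum over the classical crossings c of
    sgn(c) ([D_c] - [D]).  At a crossing not involved in a move, the move persists
    after the smoothing.  A crossing removed by the first move contributes 0.  The
    two crossings removed by the second move have opposite signs, and their
    smoothings are flat equivalent: each shows a monogon on the same diagram, or
    they differ by the names of double points.  For a smoothing at a vertex of the
    triangle of the third move, the opposite side either crosses the two new arcs
    once each, before and after the move, which gives isotopic diagrams, or it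
    crosses one of them twice and the resulting flat bigon can be removed. *)

From mathcomp Require Import all_boot all_algebra zify.
From mathcomp Require Import boolp.
From mathcomp.multinomials Require Import freeg.
From Stdlib Require Import Relation_Operators.
Require Import Defs.

Set Implicit Arguments.
Unset Strict Implicit.
Unset Printing Implicit Defensive.

Import GRing.Theory.

(** * Faces of Gauss words *)

(** A flat class is taken through [insubd], so an equivalence of words yields an equality of classes
    only if both flattened words are known to be planar. Smoothings, and the words left after
    removing a monogon or a bigon from them, therefore need planarity proofs. The Euler inequality
    supplies the upper bound on the number of faces, so only a lower bound remains: deleting k
    double points must lose at most k faces. Faces are not followed through the operation. Instead
    darts are coloured so that each face is monochromatic and k chosen pairs of darts agree, which
    leaves at least F - k colours; if glued edges have matching colours and no colour disappears,
    the new word has at least that many faces. The other obstacle is that the two passages of a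
    smoothed crossing may lie anywhere relative to the factors named by a move. Cutting words into
    chunks avoids this case distinction: smoothing permutes and reverses whole chunks, and the
    patterns of the moves depend only on the big chunks up to order. *)

Section Coloring.

Variable T : finType.

Definition merge_color (c : T -> T) (ab : T * T) (x : T) : T :=
  if c x == c ab.1 then c ab.2 else c x.

(** Only the colour [c ab.1] can disappear, since a point of any other colour keeps it. *)
Lemma merge_color_count (c : T -> T) ab :
  #|codom c| <= #|codom (merge_color c ab)| + 1.
Proof.
rewrite addn1 -add1n;
  apply: leq_trans
  (leq_add (leq_b1 (c ab.1 \notin codom (merge_color c ab))) (leqnn _)).
rewrite -cardU1; apply/subset_leq_card/subsetP => _ /codomP[x ->].
rewrite !inE; case: eqVneq => //= xa; apply/codomP; exists x.
by rewrite /merge_color (negPf xa).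
Qed.

(** Colouring by the root of the orbit gives one colour per orbit; each prescribed identification
    then costs at most one colour. *)
Lemma invariant_coloring (f : T -> T) (l : seq (T * T)) : injective f ->
  exists c : T -> T,
    [/\ forall x, c (f x) = c x, forall ab, ab \in l -> c ab.1 = c ab.2
      & fcard f T <= #|codom c| + size l].
Proof.
move=> inj_f; elim: l => [|ab l [c [c_f c_l le_c]]].
  have sym := fconnect_sym inj_f.
  exists (froot f); split=> //.
    by move=> x; apply/eqP; rewrite (root_connect sym) sym fconnect1.
  rewrite addn0; apply/subset_leq_card/subsetP => x.
  rewrite !inE andbT => /eqP <-; exact: codom_f.
exists (merge_color c ab); split.
- by move=> x; rewrite /merge_color c_f.
- move=> ab'; rewrite inE => /predU1P[->|/c_l]; last first.
    by rewrite /merge_color => ->.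
  by rewrite /merge_color eqxx; case: eqVneq.
by rewrite /= -add1n addnA (leq_trans le_c) // leq_add2r merge_color_count.
Qed.

End Coloring.

(** The pulled back colouring is constant on orbits of [f], so every colour is already taken at the
    root of some orbit. *)
Lemma coloring_count (T T' C : finType) (f : T' -> T') (psi : T' -> T)
    (c : T -> C) : injective f ->
    (forall d, c (psi (f d)) = c (psi d)) ->
    (forall d, exists d', c d = c (psi d')) ->
  #|codom c| <= fcard f T'.
Proof.
move=> inj_f c_f cov; have sym := fconnect_sym inj_f.
apply: leq_trans (leq_image_card (c \o psi) _).
apply/subset_leq_card/subsetP => _ /codomP[d ->].
have [d' ->] := cov d.
have -> : c (psi d') = c (psi (froot f d')).
  have /iter_findex <- := connect_root (frel f) d'.
  by elim: (findex _ _ _) => //= n IHn; rewrite c_f.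
apply/imageP; exists (froot f d') => //.
by rewrite !inE andbT; apply/eqP; exact: root_root.
Qed.

(** * Letters and Gauss words *)

Lemma oppK : involutive opp.
Proof. by case=> [[l k] b]; rewrite /opp /= negbK; case: k. Qed.

Lemma lab_opp x : lab (opp x) = lab x. Proof. by []. Qed.
Lemma pos_opp x : pos (opp x) = ~~ pos x. Proof. by []. Qed.

Lemma opp_neq x : opp x != x.
Proof. by case: x => [[l k] b]; apply/eqP => -[_]; case: b. Qed.

Lemma gauss_uniq w : gauss_word w -> uniq w.
Proof. by case/andP => /map_uniq. Qed.

Lemma gauss_opp w x : gauss_word w -> (opp x \in w) = (x \in w).
Proof.
case/andP=> _ /allP closed.
by apply/idP/idP => [/closed|/closed//]; rewrite oppK.
Qed.

Lemma gauss_inj w x y : gauss_word w -> x \in w -> y \in w ->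
  lab x = lab y -> pos x = pos y -> x = y.
Proof.
case/andP=> u _ xw yw lxy pxy.
have e : (lab x, pos x) = (lab y, pos y) by rewrite lxy pxy.
elim: w u xw yw => //= z w IHw /andP[nz /IHw {}IHw].
rewrite !inE => /predU1P[xz|xw] /predU1P[yz|yw]; last exact: IHw.
- by rewrite xz yz.
- by case/negP: nz; apply/mapP; exists y; rewrite // -xz.
- by case/negP: nz; apply/mapP; exists x; rewrite // -yz.
Qed.

Lemma gauss_same_lab w x y : gauss_word w -> x \in w -> y \in w ->
  lab y = lab x -> y = x \/ y = opp x.
Proof.
move=> gw xw yw lyx; case: (eqVneq (pos y) (pos x)) => pyx.
  by left; apply: gauss_inj gw _ _ _ _.
right; apply: (gauss_inj gw); rewrite ?(gauss_opp _ gw) // pos_opp.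
by move: pyx; case: (pos y); case: (pos x).
Qed.

Lemma perm_gauss w t : perm_eq w t -> gauss_word w = gauss_word t.
Proof.
move=> wt; rewrite /gauss_word (perm_uniq (perm_map _ wt)).
rewrite (perm_all _ wt); congr andb; apply: eq_all => x.
exact: perm_mem.
Qed.

Lemma gauss_filter (a : pred nat) w : gauss_word w ->
  gauss_word [seq x <- w | a (lab x)].
Proof.
move=> gw; case/andP: (gw) => u _; apply/andP; split.
  by apply: subseq_uniq u; apply: map_subseq; apply: filter_subseq.
by apply/allP => x; rewrite !mem_filter (gauss_opp _ gw).
Qed.

(** The change of orientation depends on the label alone, so the two passages of a double point stay
    opposite. *)
Lemma gauss_map (m : letter -> letter) (h : nat -> bool) w :
    (forall x, lab (m x) = lab x) ->
    (forall x, pos (m x) = pos x (+) h (lab x)) ->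
    (forall x, m (opp x) = opp (m x)) ->
  gauss_word w -> gauss_word (map m w).
Proof.
move=> ml mp mo gw; case/andP: (gw) => u _; apply/andP; split; last first.
  apply/allP => _ /mapP[x xw ->]; rewrite -mo map_f //.
  by rewrite (gauss_opp _ gw).
rewrite -map_comp map_inj_in_uniq ?(gauss_uniq gw) // => x y xw yw [].
rewrite !ml !mp => e1; rewrite e1 => /addIb e2; exact: gauss_inj gw _ _ _ _.
Qed.

(** The letter [y] is whichever of the two passages comes first, so later arguments need to treat
    only one order. *)
Lemma gauss_splits w x : gauss_word w -> x \in w ->
  exists y P Q R, (y = x \/ y = opp x) /\ w = P ++ y :: Q ++ opp y :: R.
Proof.
move=> gw xw; have := xw; rewrite -(gauss_opp _ gw) .
case/splitPr: xw => P R; rewrite mem_cat inE (negPf (opp_neq x)) /=.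
case/orP=> /splitPr[P1 P2].
  by exists (opp x), P1, P2, R; rewrite oppK -catA; split; [right|].
by exists x, P, P1, P2; split; [left|].
Qed.

(* The dart that arrives at the double point of x along the strand if e and
   against it otherwise; dart_out is the one that leaves it. *)
Definition dart_in (w : word) (x : letter) (e : bool) :
    'I_(size w).+1 * bool := (inord (index x w + ~~ e), e).
Definition dart_out (w : word) (x : letter) (e : bool) :
    'I_(size w).+1 * bool := (inord (index x w + e), e).

(** The rule of turning left in terms of letters; it confines the index arithmetic of [face_step] to
    this place. *)
Lemma face_step_in w x e : gauss_word w -> x \in w ->
  face_step w (dart_in w x e) = dart_out w (opp x) (pos x == e).
Proof.
move=> gw xw; have ltx : index x w < size w by rewrite index_mem.
rewrite /face_step /dart_in /dart_out; case: e => /=.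
  rewrite addn0 inordK; last exact: ltnW.
  rewrite ltn_eqF //= nth_index //.
  by case: (pos x) => /=; rewrite ?addn1 ?addn0.
rewrite addn1 inordK //= nth_index //.
by case: (pos x) => /=; rewrite ?addn1 ?addn0.
Qed.

Lemma face_step_head w : face_step w (ord_max, true) = (ord_max, false).
Proof. by rewrite /= eqxx. Qed.

Lemma face_step_tail w : face_step w (ord0, false) = (ord0, true).
Proof. by []. Qed.

Variant dart_in_spec w : 'I_(size w).+1 * bool -> Prop :=
| DartInHead : @dart_in_spec w (ord_max, true)
| DartInTail : @dart_in_spec w (ord0, false)
| DartIn x e of x \in w : @dart_in_spec w (dart_in w x e).

Lemma dart_inP w d : gauss_word w -> @dart_in_spec w d.
Proof.
case: d => i [] gw.
  case: (ltnP i (size w)) => [ltiw | leiw].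
    have -> : (i, true) = dart_in w (nth (0, Virtual, true) w i) true.
      rewrite /dart_in index_uniq ?gauss_uniq // addn0.
      by congr pair; apply: val_inj; rewrite /= inordK.
    by constructor; apply: mem_nth.
  suff -> : i = ord_max by constructor.
  by apply: val_inj; apply/eqP; rewrite eqn_leq leiw -ltnS ltn_ord.
case: (posnP i) => [i0 | i_gt0].
  suff -> : i = ord0 by constructor.
  exact: val_inj.
have lti : i.-1 < size w by rewrite -ltnS prednK ?ltn_ord.
have -> : (i, false) = dart_in w (nth (0, Virtual, true) w i.-1) false.
  rewrite /dart_in index_uniq ?gauss_uniq // addn1 prednK //.
  by congr pair; apply: val_inj; rewrite /= inordK.
by constructor; apply: mem_nth.
Qed.

Lemma dart_out_in w d : gauss_word w ->
  [\/ d = (ord0, true), d = (ord_max, false)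
    | exists x e, x \in w /\ d = dart_out w x e].
Proof.
case: d => i [] gw.
  case: (posnP i) => [i0 | i_gt0].
    by constructor 1; congr pair; apply: val_inj.
  have lti : i.-1 < size w by rewrite -ltnS prednK ?ltn_ord.
  constructor 3; exists (nth (0, Virtual, true) w i.-1), true.
  split; first exact: mem_nth.
  rewrite /dart_out index_uniq ?gauss_uniq // addn1 prednK //.
  by congr pair; apply: val_inj; rewrite /= inordK.
case: (ltnP i (size w)) => [ltiw | leiw].
  constructor 3; exists (nth (0, Virtual, true) w i), false.
  split; first exact: mem_nth.
  rewrite /dart_out index_uniq ?gauss_uniq // addn0.
  by congr pair; apply: val_inj; rewrite /= inordK.
constructor 2; congr pair; apply: val_inj; apply/eqP => /=.
by rewrite eqn_leq leiw -ltnS ltn_ord.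
Qed.

(** On a finite set it is enough to find a preimage of each dart: a dart leaving the double point of
    [x] comes from one arriving along [opp x]. *)
Lemma face_step_inj w : gauss_word w -> injective (face_step w).
Proof.
move=> gw; apply: in2T; apply/imset_injP/eqP.
suff -> : [set face_step w d | d in predT] = setT.
  by rewrite cardsT; apply: eq_card.
apply/setP => d; rewrite inE.
apply/imsetP; have [->|->|[x [e [xw ->]]]] := dart_out_in d gw.
- by exists (ord0, false); rewrite // face_step_tail.
- by exists (ord_max, true); rewrite // face_step_head.
exists (dart_in w (opp x) (pos (opp x) == e)) => //.
rewrite face_step_in ?(gauss_opp _ gw) // oppK; congr dart_out.
by case: (pos (opp x)) e => [] [].
Qed.

(** * Transfer of a face colouring to a reduced word *)

Section Reduction.

Variables (w : word) (C : finType) (c : 'I_(size w).+1 * bool -> C).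
Hypothesis gw : gauss_word w.
Hypothesis c_step : forall d, c (face_step w d) = c d.

(* An edge is represented by the colours of its two darts, the one in the
   direction of travel first. *)
Definition edge_color (k : nat) : C * C :=
  (c (inord k, true), c (inord k, false)).
Definition swap_pair (o : C * C) : C * C := (o.2, o.1).

(** The edge by which [x] is reached when its strand is followed in direction [e]: the second dart
    is the first one reversed. In the same way [color_out] describes the edge by which [x] is
    left. *)
Definition color_in (x : letter) e :=
  (c (dart_in w x e), c (dart_out w x (~~ e))).
Definition color_out (x : letter) e :=
  (c (dart_out w x e), c (dart_in w x (~~ e))).

Variable eps : letter -> bool.

(* In t the strand of x is followed forwards iff eps x.  Where two letters of t
   meet, the edges of w that they leave and reach must have the same colours, so
   that they can be merged into one edge of the word t. *)
Fixpoint chained (o : C * C) (t : word) (o' : C * C) : Prop :=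
  if t is x :: t' then
    o = color_in x (eps x) /\ chained (color_out x (eps x)) t' o'
  else o = o'.

Lemma chained_cat o t o1 t' o2 :
  chained o t o1 -> chained o1 t' o2 -> chained o (t ++ t') o2.
Proof.
elim: t o => [|x t IHt] o /=; first by move=> ->.
by case=> -> /IHt h /h.
Qed.

(** Edge [k] of the reduced word has the same colours whether it is seen from the letter before it
    or from the letter after it; the two ends use [o] and [o']. *)
Lemma chained_nth o t o' k : chained o t o' -> k <= size t ->
  (if k is k'.+1 then let x :=
    nth (0, Virtual, true) t k' in color_out x (eps x)
   else o) =
  (if k < size t then let x := nth (0, Virtual, true) t k in color_in x (eps x)
   else o').
Proof.
elim: t o k => [|x t IHt] o [|k] //=; first by case.
by case=> _ /IHt h /h; case: k {h}.
Qed.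

Lemma index_mid p x q : w = p ++ x :: q -> index x w = size p.
Proof.
move=> wE; have := gauss_uniq gw; rewrite wE cat_uniq /=.
case/and3P=> _ /norP[xp _] _.
by rewrite index_cat (negPf xp) /= eqxx addn0.
Qed.

Lemma color_inT p x q : w = p ++ x :: q ->
  color_in x true = edge_color (size p).
Proof.
by move=> /index_mid wE; rewrite /color_in /dart_in /dart_out wE !addn0.
Qed.

Lemma color_outT p x q : w = p ++ x :: q ->
  color_out x true = edge_color (size p).+1.
Proof.
by move=> /index_mid wE; rewrite /color_out /dart_in /dart_out wE !addn1.
Qed.

Lemma color_inF x : color_in x false = swap_pair (color_out x true).
Proof. by []. Qed.

Lemma color_outF x : color_out x false = swap_pair (color_in x true).
Proof. by []. Qed.

Lemma chained_segment p q r : w = p ++ q ++ r -> {in q, eps =1 predT} ->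
  chained (edge_color (size p)) q (edge_color (size p + size q)).
Proof.
elim: q p => [|x q IHq] p wE epsT /=; first by rewrite addn0.
have ex : eps x by apply: epsT; rewrite inE eqxx.
rewrite ex (color_inT wE) (color_outT wE); split=> //.
rewrite addnS -addSn -(size_rcons p x); apply: IHq; first by rewrite cat_rcons.
by move=> y yq; apply: epsT; rewrite inE yq orbT.
Qed.

Lemma chained_rev_segment p q r : w = p ++ q ++ r -> {in q, eps =1 pred0} ->
  chained (swap_pair (edge_color (size p + size q))) (rev q)
          (swap_pair (edge_color (size p))).
Proof.
elim: q p => [|x q IHq] p wE epsT /=; first by rewrite addn0.
have ex : eps x = false by apply: epsT; rewrite inE eqxx.
rewrite rev_cons -cats1; apply: chained_cat; last first.
  by rewrite /= ex color_inF color_outF (color_inT wE) (color_outT wE).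
rewrite addnS -addSn -(size_rcons p x); apply: IHq; first by rewrite cat_rcons.
by move=> y yq; apply: epsT; rewrite inE yq orbT.
Qed.

Lemma color_step x e : x \in w ->
  c (dart_in w x e) = c (dart_out w (opp x) (pos x == e)).
Proof. by move=> xw; rewrite -face_step_in. Qed.

Variables (t : word) (m : letter -> letter).
Hypothesis gt : gauss_word (map m t).
Hypothesis tw : {subset t <= w}.
Hypothesis t_opp : forall x, x \in t -> opp x \in t.
Hypothesis m_opp : forall x, x \in t -> m (opp x) = opp (m x).
(** Reversing one of the two strands through a double point changes the orientation there; reversing
    both does not. *)
Hypothesis m_pos : forall x, x \in t -> pos (m x) =
  pos x (+) eps x (+) eps (opp x).
Hypothesis t_chained : chained (edge_color 0) t (edge_color (size w)).

(* The colour of a face that survives in t. *)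
Definition visible (a : C) : Prop :=
  [\/ a = c (ord0, true), a = c (ord_max, true)
    | exists x e, x \in t /\ a = c (dart_in w x e)].

Hypothesis t_visible : forall x, x \in w -> x \notin t ->
  forall e, visible (c (dart_in w x e)).

(** An edge of the reduced word may be glued from several edges of [w]; it is represented by the one
    entering its next letter, and the last edge by the edge at the head. *)
Let psi (d : 'I_(size (map m t)).+1 * bool) : 'I_(size w).+1 * bool :=
  let x := nth (0, Virtual, true) t d.1 in
  if d.1 < size t then
    if d.2 then dart_in w x (eps x) else dart_out w x (~~ eps x)
  else (ord_max, d.2).

Let index_m x : x \in t -> index (m x) (map m t) = index x t.
Proof.
move=> xt; rewrite -{1}(nth_index (0, Virtual, true) xt)
  -(nth_map _ (0, Virtual, true)) ?index_mem //.
by rewrite index_uniq ?gauss_uniq // size_map index_mem.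
Qed.

Let col_psi k b : k <= size t ->
  c (psi (inord k, b)) =
  let o := if k < size t then let x := nth (0, Virtual, true) t k in
             color_in x (eps x) else edge_color (size w) in
  if b then o.1 else o.2.
Proof.
move=> ltk; rewrite /psi /= inordK ?size_map ?ltnS //.
case: ifP => _; first by case: b.
have -> : ord_max = inord (size w) :> 'I_(size w).+1.
  by apply: val_inj; rewrite /= inordK.
by case: b.
Qed.

Let col_in x e : x \in t ->
  c (psi (dart_in (map m t) (m x) e)) = c (dart_in w x (e == eps x)).
Proof.
move=> xt; have lx : index x t < size t by rewrite index_mem.
rewrite /dart_in index_m // col_psi; last by case: e; lia.
case: e => /=.
  by rewrite addn0 lx nth_index //=; case: (eps x).
by rewrite addn1 -(chained_nth t_chained) //= nth_index //=; case: (eps x).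
Qed.

Let col_out x e : x \in t ->
  c (psi (dart_out (map m t) (m x) e)) = c (dart_out w x (e == eps x)).
Proof.
move=> xt; have lx : index x t < size t by rewrite index_mem.
rewrite /dart_out index_m // col_psi; last by case: e; lia.
case: e => /=; last first.
  by rewrite addn0 lx nth_index //=; case: (eps x).
by rewrite addn1 -(chained_nth t_chained) //= nth_index //=; case: (eps x).
Qed.

Let ord_maxE (v : word) : ord_max = inord (size v) :> 'I_(size v).+1.
Proof. by apply: val_inj; rewrite /= inordK. Qed.

Let ord_0E (v : word) : ord0 = inord 0 :> 'I_(size v).+1.
Proof. by apply: val_inj; rewrite /= inordK. Qed.

Let col_head b : c (psi (ord_max, b)) = c (ord_max, true).
Proof.
rewrite {1}ord_maxE col_psi ?size_map // ltnn /edge_color /= -ord_maxE.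
by case: b; rewrite // -face_step_head c_step.
Qed.

Let col_tail b : c (psi (ord0, b)) = c (ord0, true).
Proof.
rewrite {1}ord_0E col_psi // -(chained_nth t_chained) // /edge_color /= -ord_0E.
by case: b; rewrite // -face_step_tail c_step.
Qed.

(** Turning left in the reduced word corresponds under [psi] to turning left in [w], up to edges of
    equal colours; visibility ensures that [psi] meets every colour. *)
Lemma reduction_count : #|codom c| <= fcard (face_step (map m t)) predT.
Proof.
apply: (coloring_count (psi := psi)); first exact: face_step_inj.
- move=> d; case: (dart_inP d gt) => [||_ e /mapP[x xt ->]].
  + by rewrite face_step_head !col_head.
  + by rewrite face_step_tail !col_tail.
  rewrite face_step_in ?map_f // col_in // -m_opp // col_out ?t_opp //.
  rewrite color_step ?tw // m_pos //; congr (c (dart_out _ _ _)).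
  by case: (pos x); case: (eps x); case: (eps (opp x)); case: e.
move=> d.
have vis_psi a : visible a -> exists d', a = c (psi d').
  case=> [->|->|[x [e [xt ->]]]].
  - by exists (ord0, true); rewrite col_tail.
  - by exists (ord_max, true); rewrite col_head.
  exists (dart_in (map m t) (m x) (e == eps x)); rewrite col_in //.
  by congr (c (dart_in _ _ _)); case: e; case: (eps x).
apply: vis_psi; case: (dart_inP d gw) => [||x e xw].
- by constructor 2.
- by constructor 1; rewrite -c_step face_step_tail.
case: (boolP (x \in t)) => xt; last exact: t_visible.
by constructor 3; exists x, e.
Qed.

End Reduction.

(** * Planarity of smoothings and of bigon removals *)

(** The last hypothesis ranges over all colourings because the one supplied by [invariant_coloring]
    is known only through its properties. Each pair in [l] accounts for at most one lost face. *)
Lemma reduction_faces w t (m : letter -> letter) (eps : letter -> bool) l :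
    gauss_word w -> gauss_word (map m t) -> {subset t <= w} ->
    (forall x, x \in t -> opp x \in t) ->
    (forall x, x \in t -> m (opp x) = opp (m x)) ->
    (forall x, x \in t -> pos (m x) = pos x (+) eps x (+) eps (opp x)) ->
    (forall (C : finType) (c : 'I_(size w).+1 * bool -> C),
      (forall d, c (face_step w d) = c d) ->
      (forall ab, ab \in l -> c ab.1 = c ab.2) ->
      chained c eps (edge_color c 0) t (edge_color c (size w)) /\
      forall x, x \in w -> x \notin t ->
        forall e, visible c t (c (dart_in w x e))) ->
  fcard (face_step w) predT <= fcard (face_step (map m t)) predT + size l.
Proof.
move=> gw gt tw t_opp m_opp m_pos H.
have [c [c_step c_l le_c]] := invariant_coloring l (face_step_inj gw).
have [t_chained t_visible] := H _ c c_step c_l.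
apply: leq_trans le_c _; rewrite leq_add2r.
exact: (reduction_count gw c_step gt tw t_opp m_opp m_pos t_chained t_visible).
Qed.

Lemma count_lab w Q y : gauss_word w -> uniq Q -> {subset Q <= w} -> y \in w ->
  count_mem (lab y) (map lab Q) = (y \in Q) + (opp y \in Q).
Proof.
move=> gw uQ Qw yw; rewrite -!count_uniq_mem // count_map -count_predUI.
rewrite [X in _ = _ + X](_ : _ = 0) ?addn0; last first.
  rewrite (@eq_count _ _ pred0) ?count_pred0 // => z /=.
  by case: eqVneq => //= ->; rewrite eq_sym (negPf (opp_neq y)).
apply: eq_in_count => z /Qw zw /=; apply/eqP/orP => [lzy|[]/eqP->] //.
by have [->|->] := gauss_same_lab gw yw zw lzy; rewrite eqxx; auto.
Qed.

Definition flip (Q : word) (x : letter) : letter :=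
  (lab x, knd x, pos x (+) (count_mem (lab x) (map lab Q) == 1)).

Lemma flip_opp Q x : flip Q (opp x) = opp (flip Q x).
Proof. by rewrite /flip /opp addNb. Qed.

(** One corner of a double point, in terms of positions; the two letters and the two values of [e]
    give its four corners. *)
Lemma turn w (C : Type) (c : 'I_(size w).+1 * bool -> C) p x q p' q' e :
    gauss_word w -> (forall d, c (face_step w d) = c d) ->
    w = p ++ x :: q -> w = p' ++ opp x :: q' ->
  c (inord (size p + ~~ e), e) =
  c (inord (size p' + ~~ (pos x (+) e)), ~~ (pos x (+) e)).
Proof.
move=> gw c_step wE wE'.
have xw : x \in w by rewrite wE mem_cat inE eqxx orbT.
have := c_step (dart_in w x e); rewrite face_step_in //.
rewrite /dart_in /dart_out (index_mid gw wE) (index_mid gw wE').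
have -> : (pos x == e) = ~~ (pos x (+) e) by case: (pos x) e => [] [].
by [].
Qed.

(** The edge at which [t2] starts either leads to a kept letter or, if [t2] is empty, ends at the
    head; its colours survive in both cases. *)
Lemma visible_cat w (C : finType) (c : 'I_(size w).+1 * bool -> C) eps t1 t2 o :
    gauss_word w -> (forall d, c (face_step w d) = c d) ->
      {subset t1 ++ t2 <= w} ->
    (forall x, x \in t1 ++ t2 -> opp x \in t1 ++ t2) ->
    chained c eps o t2 (edge_color c (size w)) ->
  visible c (t1 ++ t2) o.1 /\ visible c (t1 ++ t2) o.2.
Proof.
move=> gw c_step tw t_opp; case: t2 => [|x t2] in tw t_opp *.
  move=> /= ->; rewrite /edge_color /=.
  have -> : inord (size w) = ord_max :> 'I_(size w).+1.
    by apply: val_inj; rewrite /= inordK.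
  by split; constructor 2; rewrite // -face_step_head c_step.
case=> -> _; have xt : x \in t1 ++ x :: t2 by rewrite mem_cat inE eqxx orbT.
rewrite /color_in /=; split; constructor 3; first by exists x, (eps x).
(* The reversed dart leaves the double point of [x], so it has the colour of the dart that arrives
   there along [opp x]. *)
exists (opp x), (pos (opp x) == ~~ eps x); split; first exact: t_opp.
rewrite (color_step gw c_step) ?tw ?t_opp // oppK; congr (c (dart_out _ _ _)).
by case: (pos (opp x)); case: (eps x).
Qed.

Section Smoothing.

Variables (w P Q R : word) (x : letter).
Hypothesis gw : gauss_word w.
Hypothesis wE : w = P ++ x :: Q ++ opp x :: R.

Let uw := gauss_uniq gw.

Lemma smoothing_perm : perm_eq w (x :: opp x :: P ++ rev Q ++ R).
Proof.
rewrite wE; apply/permP => a; rewrite !(count_cat, count_rev, count_rev) /=.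
by rewrite !count_cat /= count_rev; lia.
Qed.

Lemma smoothing_mem y : (y \in P ++ rev Q ++ R) = (y \in w) && (lab y != lab x).
Proof.
rewrite (perm_mem smoothing_perm) !inE.
have := uw; rewrite (perm_uniq smoothing_perm) /= inE.
case/and3P=> /norP[_ nx] nox _.
have xw : x \in w by rewrite (perm_mem smoothing_perm) inE eqxx.
case: (boolP (y \in P ++ _)) => yt; last first.
  rewrite orbF; case: eqVneq => [->|_] /=; first by rewrite eqxx.
  by case: eqVneq => [->|] //=; rewrite eqxx.
rewrite !orbT /=; apply/esym/negP => /eqP lyx.
have yw : y \in w by rewrite (perm_mem smoothing_perm) !inE yt !orbT.
by case: (gauss_same_lab gw xw yw lyx) => yE; move: yt;
  rewrite yE ?(negPf nx) ?(negPf nox).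
Qed.

Lemma smoothing_gauss : gauss_word (P ++ rev Q ++ R).
Proof.
have := gauss_filter (fun l => l != lab x) gw;
  rewrite -(perm_gauss (w := P ++ rev Q ++ R)) //.
apply: uniq_perm.
- by have := uw; rewrite (perm_uniq smoothing_perm) /= => /and3P[].
- exact: filter_uniq.
by move=> y; rewrite mem_filter smoothing_mem andbC.
Qed.

Lemma smoothing_count y : y \in w ->
  (count_mem (lab y) (map lab Q) == 1) = (y \in Q) (+) (opp y \in Q).
Proof.
move=> yw; rewrite (count_lab gw) //.
- by case: (y \in Q); case: (opp y \in Q).
- by have := uw; rewrite wE cat_uniq /= cat_uniq => /and5P[_ _ _ ->].
by move=> z zQ; rewrite wE !(mem_cat, inE) zQ !orbT.
Qed.

Lemma smoothing_disjoint y : y \in Q -> (y \notin P) && (y \notin R).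
Proof.
move=> yQ; have := uw; rewrite wE cat_uniq /= cat_uniq /=.
case/and5P=> _ /norP[_ /hasPn nP] _ _ /andP[/norP[_ /hasPn nR] _].
rewrite nP ?mem_cat ?yQ //=; apply/negP => /nR.
by rewrite /= yQ.
Qed.

(** Once two opposite corners share a colour, the corner equalities match the colours of the two
    incoming edges ([e1]) and of the two outgoing edges ([e2]), exactly the pairs that the smoothing
    joins. *)
Lemma smoothing_faces (m : letter -> letter) :
    (forall y, lab (m y) = lab y) ->
    (forall y, pos (m y) = pos (flip Q y)) ->
    (forall y, m (opp y) = opp (m y)) ->
  fcard (face_step w) predT <=
    fcard (face_step (map m (P ++ rev Q ++ R))) predT + 1.
Proof.
move=> m_lab m_pos m_opp.
(* d1 and d2 lie in the two opposite corners that the smoothing joins. *)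
pose d1 : 'I_(size w).+1 * bool := (inord (size P), pos x).
pose d2 : 'I_(size w).+1 * bool := (inord (size P + (size Q).+1), ~~ pos x).
have tw : {subset P ++ rev Q ++ R <= w}.
  by move=> y; rewrite smoothing_mem => /andP[].
have t_opp y : y \in P ++ rev Q ++ R -> opp y \in P ++ rev Q ++ R.
  by rewrite !smoothing_mem (gauss_opp _ gw).
apply: (@reduction_faces w _ m (fun y => y \notin Q) [:: (d1, d2)]) => //.
- apply: (gauss_map (h := fun l => count_mem l (map lab Q) == 1)) => //.
  exact: smoothing_gauss.
- move=> y /tw yw; rewrite m_pos /flip /= smoothing_count //.
  by rewrite /pos /=; case: (y \in Q); case: (opp y \in Q);
    rewrite ?addbT ?addbF ?negbK.
move=> C c c_step c_d; have {}c_d := c_d (d1, d2) (mem_head _ _).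
have wE' : w = (P ++ x :: Q) ++ opp x :: R by rewrite wE -catA.
have wE'' : w = P ++ opp (opp x) :: (Q ++ opp x :: R) by rewrite oppK.
have := turn true gw c_step wE wE'; have := turn false gw c_step wE wE'.
have := turn true gw c_step wE' wE''; have := turn false gw c_step wE' wE''.
rewrite pos_opp !size_cat /= !addn0 !addn1 => h1 h2 h3 h4.
have e1 : edge_color c (size P) =
  swap_pair (edge_color c (size P + (size Q).+1)).
  move: c_d h1 h2 h3 h4; rewrite /d1 /d2 /edge_color /swap_pair /=.
  by case: (pos x) => /=; rewrite ?addn0 ?addn1 => -> *; congr (_, _);
    congruence.
have e2 : swap_pair (edge_color c (size P).+1) =
  edge_color c (size P + (size Q).+1).+1.
  move: c_d h1 h2 h3 h4; rewrite /d1 /d2 /edge_color /swap_pair /=.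
  by case: (pos x) => /=; rewrite ?addn0 ?addn1 => -> *; congr (_, _);
    congruence.
have c3 : chained c (fun y => y \notin Q)
  (edge_color c (size P + (size Q).+1).+1) R
           (edge_color c (size w)).
  have -> : size w = size (P ++ x :: rcons Q (opp x)) + size R.
    by rewrite wE !(size_cat, size_rcons, size_rcons) /= !size_cat size_rcons
      /=; lia.
  have -> : (size P + (size Q).+1).+1 = size (P ++ x :: rcons Q (opp x)).
    by rewrite size_cat /= size_rcons; lia.
  apply: (chained_segment c gw (r := [::])).
    by rewrite cats0 wE -catA /= cat_rcons.
  by move=> y yR /=; apply: contraTT yR;
    rewrite negbK => /smoothing_disjoint/andP[].
have c2 : chained c (fun y => y \notin Q) (edge_color c (size P)) (rev Q)
           (edge_color c (size P + (size Q).+1).+1).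
  rewrite e1 -e2 -addSnnS -(size_rcons P x).
  apply: (chained_rev_segment c gw (r := opp x :: R));
    first by rewrite cat_rcons.
  by move=> y yQ /=; rewrite yQ.
have c1 : chained c (fun y => y \notin Q) (edge_color c 0) P
  (edge_color c (size P)).
  apply: (chained_segment c gw (p := [::]) (r := x :: Q ++ opp x :: R)) =>
    // y yP /=.
  by apply: contraTT yP; rewrite negbK => /smoothing_disjoint/andP[].
split; first by apply: chained_cat c1 (chained_cat c2 c3).
have [v1 v2] := visible_cat gw c_step tw t_opp (chained_cat c2 c3).
(* The four darts arriving at the removed crossing lie on the two glued edges, so the visibility of
   these suffices. *)
have [v3 v4] : visible c (P ++ rev Q ++ R)
  (edge_color c (size P + (size Q).+1).+1).1 /\ visible c (P ++ rev Q ++ R)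
  (edge_color c (size P + (size Q).+1).+1).2.
  by rewrite catA; apply: (visible_cat gw c_step _ _ c3); rewrite -catA.
move=> y yw; rewrite smoothing_mem yw /= negbK => /eqP lyx.
have xw : x \in w by rewrite wE mem_cat inE eqxx orbT.
have [->|->] := gauss_same_lab gw xw yw lyx => -[];
  rewrite /dart_in ?(index_mid gw wE) ?(index_mid gw wE') /= ?size_cat /=
  ?addn0 ?addn1.
- by move: v1; rewrite /edge_color.
- by move: v3; rewrite -e2.
- by move: v2; rewrite e1.
- by move: v4.
Qed.

End Smoothing.

Lemma euler_inequality w : gauss_word w ->
  fcard (face_step w) predT <= (size w)./2.+1.
Proof.
have [n] := ubnP (size w); elim: n w => // n IHn w le_w_n gw.
case: (posnP (size w)) => [/size0nil->|w_gt0].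
  by case/and3P: (nil_is_diagram predT) => _ /eqP-> _.
have [x xw] : exists x, x \in w.
  by case: (w) w_gt0 => // y v; exists y; rewrite mem_head.
have [y [P [Q [R [_ wE]]]]] := gauss_splits gw xw.
have := smoothing_faces gw wE (m := flip Q) (fun=> erefl) (fun=> erefl)
  (flip_opp Q).
have sz : size w = (size (map (flip Q) (P ++ rev Q ++ R))).+2.
  by rewrite (perm_size (smoothing_perm gw wE)) size_map.
move/leq_trans; apply; rewrite addn1 sz ltnS /=; apply: IHn.
  by apply: ltnW; rewrite -ltnS -sz.
apply: (gauss_map (h := fun l => count_mem l (map lab Q) == 1)) => //.
  exact: flip_opp.
exact: smoothing_gauss gw wE.
Qed.

(** Deleting k double points lowers the number of faces required for planarity by exactly k, and the
    Euler inequality forbids more faces than required. *)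
Lemma planar_reduction w w' k : gauss_word w' -> size w = size w' + k.*2 ->
    fcard (face_step w) predT <= fcard (face_step w') predT + k ->
  planar w -> planar w'.
Proof.
move=> gw' sz le_k /eqP pw; rewrite /planar eqn_leq euler_inequality //=.
by move: le_k; rewrite pw sz halfD doubleK odd_double andbF add0n -addSn
  leq_add2r.
Qed.

Definition flat_letter (x : letter) : letter :=
  (lab x, flatten_kind (knd x), pos x).

Lemma flat_letter_opp x : flat_letter (opp x) = opp (flat_letter x).
Proof. by case: x => [[l k] b]; rewrite /flat_letter /opp /=; case: k. Qed.

Lemma perm_fresh w x t : gauss_word w -> perm_eq w (x :: opp x :: t) ->
  {in t, forall z, lab z != lab x}.
Proof.
move=> gw wt z zt; apply/eqP => lzx.
have := gauss_uniq gw;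
  rewrite (perm_uniq wt) /= inE => /and3P[/norP[_ nx] nox _].
have xw : x \in w by rewrite (perm_mem wt) inE eqxx.
have zw : z \in w by rewrite (perm_mem wt) !inE zt !orbT.
by case: (gauss_same_lab gw xw zw lzx) zt => ->;
  rewrite ?(negPf nx) ?(negPf nox).
Qed.

Lemma flatten_gauss w : gauss_word w -> gauss_word (flatten_word w).
Proof.
apply: (gauss_map (m := flat_letter) (h := fun=> false)) => //.
  by move=> x; rewrite addbF.
exact: flat_letter_opp.
Qed.

(** Faces do not depend on kinds, but [face_step] looks letters up together with their kinds; the
    comparison is a reduction that deletes nothing. *)
Lemma flatten_planar w : gauss_word w -> planar w -> planar (flatten_word w).
Proof.
move=> gw; apply: (@planar_reduction _ _ 0) (flatten_gauss gw) _ _.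
  by rewrite size_map addn0.
apply: (@reduction_faces w w flat_letter predT [::]) => //.
- exact: flatten_gauss.
- by move=> x; rewrite (gauss_opp _ gw).
- by move=> x _; rewrite flat_letter_opp.
- by move=> x _; rewrite /= addbK.
move=> C c c_step _; split; last by move=> x ->.
by apply: (chained_segment c gw (p := [::]) (r := [::])); rewrite ?cats0.
Qed.

Lemma flatten_word_flat w : all (fun x => pred2 Flat Virtual (knd x))
  (flatten_word w).
Proof. by apply/allP => _ /mapP[[[l k] b] _ ->] /=; case: k. Qed.

Lemma flatten_diagram P w : is_diagram P w ->
  is_diagram (pred2 Flat Virtual) (flatten_word w).
Proof.
case/and3P=> gw pw _; apply/and3P; split; first exact: flatten_gauss.
  exact: flatten_planar.
exact: flatten_word_flat.
Qed.

Lemma flip_gauss Q t : gauss_word t -> gauss_word (map (flip Q) t).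
Proof.
apply: (gauss_map (h := fun l => count_mem l (map lab Q) == 1)) => //.
exact: flip_opp.
Qed.

Lemma smoothing_diagram K w P x Q R : is_diagram K w ->
    w = P ++ x :: Q ++ opp x :: R ->
  is_diagram K (map (flip Q) (P ++ rev Q ++ R)).
Proof.
move=> dw wE; case/and3P: (dw) => gw pw Kw; apply/and3P; split.
- by apply: flip_gauss; apply: smoothing_gauss gw wE.
- apply: (@planar_reduction w _ 1 _ _ _ pw).
  + by apply: flip_gauss; apply: smoothing_gauss gw wE.
  + by rewrite size_map (perm_size (smoothing_perm gw wE)) addn2.
  exact: (smoothing_faces gw wE (m := flip Q) (fun=> erefl) (fun=> erefl)
    (flip_opp Q)).
apply/allP => _ /mapP[y yt ->]; apply: (allP Kw y).
by move: yt; rewrite (smoothing_mem gw wE) => /andP[].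
Qed.

(** The second move is isolated because its result must sometimes be proved planar: smoothing a
    vertex of a triangle can create a bigon whose removal gives a word not known beforehand to be a
    diagram. *)
Inductive bigon : word -> word -> Prop :=
| Bigon x y b p q r of
    b = [:: opp x; opp y] \/ b = [:: opp y; opp x] &
    knd x = knd y & pos x != pos y :
    bigon (p ++ [:: x; y] ++ q ++ b ++ r) (p ++ q ++ r).

Lemma bigon_move w w' : bigon w w' -> move w w'.
Proof. by case=> *; apply: move2. Qed.

Lemma bigon_perm x y b p q r : b = [:: opp x; opp y] \/ b = [:: opp y; opp x] ->
  perm_eq (p ++ [:: x; y] ++ q ++ b ++ r)
    (x :: opp x :: y :: opp y :: p ++ q ++ r).
Proof.
move=> bE; apply/permP => a; rewrite !count_cat /= !count_cat.
by case: bE => -> /=; lia.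
Qed.

(** Deletion by labels does not mention positions and commutes with smoothing at another
    crossing. *)
Lemma bigon_filter w x y b p q r : w = p ++ [:: x; y] ++ q ++ b ++ r ->
    b = [:: opp x; opp y] \/ b = [:: opp y; opp x] -> gauss_word w ->
  p ++ q ++ r = [seq z <- w | lab z \notin [:: lab x; lab y]].
Proof.
move=> wE bE gw; have := bigon_perm p q r bE; rewrite -wE => wt.
have wt' : perm_eq w (y :: opp y :: x :: opp x :: p ++ q ++ r).
  by apply: perm_trans wt _; apply/permP => a /=; lia.
have fx := perm_fresh gw wt; have fy := perm_fresh gw wt'.
have F u : {subset u <= p ++ q ++ r} ->
  [seq z <- u | lab z \notin [:: lab x; lab y]] = u.
  move=> ut; apply/all_filterP/allP => z /ut zt.
  by rewrite !inE negb_or fx ?fy // !inE zt !orbT.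
have -> : [seq z <- w | lab z \notin [:: lab x; lab y]] =
    [seq z <- p ++ q ++ r | lab z \notin [:: lab x; lab y]].
  by rewrite wE !filter_cat /=; case: bE => -> /=; rewrite !inE !eqxx ?orbT.
by rewrite F.
Qed.

Lemma bigon_faces w w' : gauss_word w -> bigon w w' ->
  fcard (face_step w) predT <= fcard (face_step w') predT + 2.
Proof.
move=> gw ww'; case: ww' gw => {w w'} x y b p q r bE _ nxy gw.
set w := p ++ _ in gw *; set t := p ++ q ++ r.
have gt : gauss_word t.
  by rewrite /t (bigon_filter erefl bE gw);
    exact: (gauss_filter (fun l => l \notin [:: lab x; lab y])).
have memw z : (z \in w) =
  (z \in t) || (lab z \in [:: lab x; lab y]) && (z \in w).
  rewrite [t](bigon_filter erefl bE gw) mem_filter.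
  by case: (z \in w); case: (lab z \in _).
have tw : {subset t <= w} by move=> z zt; rewrite memw zt.
have t_opp z : z \in t -> opp z \in t by rewrite (gauss_opp _ gt).
pose i := size p; pose j := i + (size q).+2.
(* The bigon lies to the left of the dart [(i.+1, ~~ s)]. Its side depends on [pos x] and on whether
   the two strands are parallel or antiparallel, but not on the colouring, so [s] can be fixed
   before the pairs to be identified. *)
have [s colors] : exists s,
  forall (C : finType) (c : 'I_(size w).+1 * bool -> C),
    (forall d, c (face_step w d) = c d) ->
    let cc k e := c (inord k, e) in
    cc i s = cc i.+2 s -> cc i.+1 (~~ s) = cc i (~~ s) ->
  [/\ edge_color c i = edge_color c i.+2, edge_color c j = edge_color c j.+2
    & forall e, (exists e', cc i.+1 e = cc i e' \/ cc i.+1 e = cc j e') /\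
                (exists e', cc j.+1 e = cc i e' \/ cc j.+1 e = cc j e')].
  have py : pos y = ~~ pos x by move: nxy; case: (pos x); case: (pos y).
  have i1 : i.+1 = size (rcons p x) by rewrite size_rcons.
  have jE : j = size (p ++ [:: x; y] ++ q) by rewrite !size_cat.
  have j1 z : j.+1 = size (rcons (p ++ [:: x; y] ++ q) z).
    by rewrite size_rcons -jE.
  case: bE => bE; [exists (~~ pos x)|exists (pos x)] => C c c_step cc.
    have wx : w = p ++ x :: (y :: q ++ b ++ r) by [].
    have wx'' : w = p ++ opp (opp x) :: (y :: q ++ b ++ r) by rewrite oppK.
    have wy : w = rcons p x ++ y :: (q ++ b ++ r) by rewrite cat_rcons.
    have wy'' : w = rcons p x ++ opp (opp y) :: (q ++ b ++ r) by rewrite oppK.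
    have wx' : w = (p ++ [:: x; y] ++ q) ++ opp x :: (opp y :: r).
      by rewrite /w bE -!catA.
    have wy' : w = rcons (p ++ [:: x; y] ++ q) (opp x) ++ opp y :: r.
      by rewrite /w bE cat_rcons -!catA.
    (* One colour equality for each of the eight corners at the two double points; with the two
       identifications they imply everything claimed. *)
    have := turn true gw c_step wx wx'; have := turn false gw c_step wx wx'.
    have := turn true gw c_step wy wy'; have := turn false gw c_step wy wy'.
    have := turn true gw c_step wx' wx''; have := turn false gw c_step wx' wx''.
    have := turn true gw c_step wy' wy''; have := turn false gw c_step wy' wy''.
    rewrite !pos_opp py -i1 -jE -j1 /cc /edge_color.
    by case: (pos x); rewrite /= ?addn0 ?addn1 -/i; clear - c i j => *; split;
      try (congr (_, _); congruence); case; split;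
      solve [exists true; solve [left; congruence | right; congruence]
            | exists false; solve [left; congruence | right; congruence]].
  have wx : w = p ++ x :: (y :: q ++ b ++ r) by [].
  have wx'' : w = p ++ opp (opp x) :: (y :: q ++ b ++ r) by rewrite oppK.
  have wy : w = rcons p x ++ y :: (q ++ b ++ r) by rewrite cat_rcons.
  have wy'' : w = rcons p x ++ opp (opp y) :: (q ++ b ++ r) by rewrite oppK.
  have wy' : w = (p ++ [:: x; y] ++ q) ++ opp y :: (opp x :: r).
    by rewrite /w bE -!catA.
  have wx' : w = rcons (p ++ [:: x; y] ++ q) (opp y) ++ opp x :: r.
    by rewrite /w bE cat_rcons -!catA.
  have := turn true gw c_step wx wx'; have := turn false gw c_step wx wx'.
  have := turn true gw c_step wy wy'; have := turn false gw c_step wy wy'.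
  have := turn true gw c_step wx' wx''; have := turn false gw c_step wx' wx''.
  have := turn true gw c_step wy' wy''; have := turn false gw c_step wy' wy''.
  rewrite !pos_opp py -i1 -jE -j1 /cc /edge_color.
  by case: (pos x); rewrite /= ?addn0 ?addn1 -/i; clear - c i j => *; split;
    try (congr (_, _); congruence); case; split;
    solve [exists true; solve [left; congruence | right; congruence]
          | exists false; solve [left; congruence | right; congruence]].
(* The first pair joins the faces at the two ends of the bigon, the second one
   absorbs the bigon. *)
pose l : seq (('I_(size w).+1 * bool) * ('I_(size w).+1 * bool)) :=
  [:: ((inord i, s), (inord i.+2, s)); ((inord i.+1, ~~ s), (inord i, ~~ s))].
have := @reduction_faces w t id predT l; rewrite map_id; apply=> //.
  by move=> z _; rewrite addbK.
move=> C c c_step c_l.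
have c1 := c_l _ (mem_head _ _).
have {c_l}c2 : c (inord i.+1, ~~ s) = c (inord i, ~~ s).
  by apply: (c_l (_, _)); rewrite !inE eqxx orbT.
have [ei ej mid] := colors C c c_step c1 c2.
have ch1 : chained c predT (edge_color c 0) p (edge_color c i).
  exact: (chained_segment c gw (p := [::])).
have ch2 : chained c predT (edge_color c i) q (edge_color c j).
  have -> : j = size (p ++ [:: x; y]) + size q by rewrite size_cat -addnA.
  have -> : edge_color c i = edge_color c (size (p ++ [:: x; y])).
    by rewrite ei size_cat addn2.
  by apply: (chained_segment c gw (r := b ++ r)); rewrite // -catA.
have szb : size b = 2 by case: bE => ->.
have ch3 : chained c predT (edge_color c j) r (edge_color c (size w)).
  have -> : size w = size (p ++ [:: x; y] ++ q ++ b) + size r.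
    by rewrite /w !size_cat !addnA.
  have -> : edge_color c j = edge_color c (size (p ++ [:: x; y] ++ q ++ b)).
    by rewrite ej !size_cat szb /=; congr edge_color; lia.
  by apply: (chained_segment c gw (r := [::])); rewrite // cats0 -!catA.
split; first by apply: chained_cat ch1 (chained_cat ch2 ch3).
have [vi1 vi2] := visible_cat gw c_step tw t_opp (chained_cat ch2 ch3).
have [vj1 vj2] : visible c t (edge_color c j).1 /\ visible c t
  (edge_color c j).2.
  by rewrite /t catA; apply: (visible_cat gw c_step _ _ ch3); rewrite -catA.
have vi e : visible c t (c (inord i, e)) by case: e.
have vj e : visible c t (c (inord j, e)) by case: e.
have vi1' e : visible c t (c (inord i.+1, e)) by have [[e' [->|->]] _] := mid e.
have vj1' e : visible c t (c (inord j.+1, e)) by have [_ [e' [->|->]]] := mid e.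
have vi2' e : visible c t (c (inord i.+2, e)).
  by move: ei (vi e); rewrite /edge_color => -[E1 E2]; case: (e);
    rewrite ?E1 ?E2.
have vj2' e : visible c t (c (inord j.+2, e)).
  by move: ej (vj e); rewrite /edge_color => -[E1 E2]; case: (e);
    rewrite ?E1 ?E2.
move=> z zw zt e.
have : z \in [:: x; y] ++ b.
  have := zw; rewrite {1}/w !mem_cat; move: zt; rewrite !mem_cat !negb_or.
  by case/and3P=> /negPf-> /negPf-> /negPf->; rewrite !orbF.
have szj : size (p ++ [:: x; y] ++ q) = j by rewrite !size_cat.
rewrite mem_cat !inE => /orP[/orP[] /eqP zE|zb].
- have wE : w = p ++ z :: (y :: q ++ b ++ r) by rewrite zE.
  by rewrite /dart_in (index_mid gw wE); case: (e); rewrite /= ?addn0 ?addn1.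
- have wE : w = rcons p x ++ z :: (q ++ b ++ r) by rewrite cat_rcons zE.
  by rewrite /dart_in (index_mid gw wE) size_rcons; case: (e);
    rewrite /= ?addn0 ?addn1.
have [b0 [b1 {}bE]] : exists b0 b1, b = [:: b0; b1].
  by case: bE => ->; [exists (opp x), (opp y)|exists (opp y), (opp x)].
move: zb; rewrite bE !inE => /orP[] /eqP zE.
- have wE : w = (p ++ [:: x; y] ++ q) ++
    z :: (b1 :: r) by rewrite /w bE zE -!catA.
  by rewrite /dart_in (index_mid gw wE) szj; case: (e);
    rewrite /= ?addn0 ?addn1.
have wE : w = rcons (p ++ [:: x; y] ++ q) b0 ++
  z :: r by rewrite /w bE zE cat_rcons -!catA.
by rewrite /dart_in (index_mid gw wE) size_rcons szj; case: (e);
  rewrite /= ?addn0 ?addn1.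
Qed.

Lemma bigon_diagram K w w' : bigon w w' -> is_diagram K w -> is_diagram K w'.
Proof.
move=> ww' /and3P[gw pw Kw].
have [gw' Kw' sz] :
  [/\ gauss_word w', all (fun x => K (knd x)) w' & size w = size w' + 4].
  case: ww' gw Kw => x y b p q r bE _ _ gw Kw.
  split; last by rewrite (perm_size (bigon_perm p q r bE)) /= addn4.
  - by rewrite (bigon_filter erefl bE gw);
      exact: (gauss_filter (fun l => l \notin [:: lab x; lab y])).
  - by move: Kw; rewrite (perm_all _ (bigon_perm p q r bE)) /= => /and5P[].
apply/and3P; split=> //; apply: (@planar_reduction w _ 2) pw => //.
exact: bigon_faces.
Qed.

(** * Moves and smoothings *)

(** No letter of [P], [Q] or [R] has the label of [x], so the two searches in [smooth] stop at the
    displayed letters. *)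
Lemma smoothE w P x Q R : gauss_word w -> w = P ++ x :: Q ++ opp x :: R ->
  smooth (lab x) w = map (flip Q) (P ++ rev Q ++ R).
Proof.
move=> gw wE; have fresh := perm_fresh gw (smoothing_perm gw wE).
have hasF u : {subset u <= P ++ rev Q ++ R} ->
  has (fun z => lab z == lab x) u = false.
  by move=> ut; apply/negbTE/hasPn => z /ut; apply: fresh.
rewrite /smooth wE find_cat hasF /=; last by move=> z; rewrite mem_cat => ->.
rewrite eqxx addn0 take_size_cat // -cat_rcons drop_size_cat ?size_rcons //.
rewrite find_cat hasF /=; last by move=> z zQ; rewrite !mem_cat mem_rev zQ orbT.
rewrite eqxx addn0 take_size_cat // -cat_rcons drop_size_cat ?size_rcons //.
Qed.

Notation flat_kinds := (pred2 Flat Virtual).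

Lemma flatten_word_id w : all (fun x => flat_kinds (knd x)) w ->
  flatten_word w = w.
Proof.
move=> /allP flat_w; rewrite -[RHS]map_id;
  apply/eq_in_map => -[[l k] b] /flat_w.
by case: k.
Qed.

(** The planarity proofs enter here: they ensure that the default value of [insubd] is not taken. *)
Lemma flat_class_equiv v v' (dv : is_diagram flat_kinds (flatten_word v))
    (dv' : is_diagram flat_kinds (flatten_word v')) :
  flat_equiv (Diagram dv) (Diagram dv') -> flat_class v = flat_class v'.
Proof.
move=> vv'; rewrite /flat_class.
have E u (du : is_diagram flat_kinds u) :
    insubd (nil_diagram flat_kinds) u = Diagram du.
  by apply: val_inj; rewrite insubdK.
by rewrite (E _ dv) (E _ dv'); apply/eqquotP/asboolP.
Qed.

Lemma flat_class_move v v' : is_diagram flat_kinds (flatten_word v) ->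
    is_diagram flat_kinds (flatten_word v') ->
    move (flatten_word v) (flatten_word v') ->
  flat_class v = flat_class v'.
Proof.
by move=> dv dv' vv'; apply: (flat_class_equiv (dv := dv) (dv' := dv'));
  apply: rst_step; constructor 2.
Qed.

Lemma flat_class_isotopic v v' : is_diagram flat_kinds (flatten_word v) ->
    is_diagram flat_kinds (flatten_word v') ->
    isotopic (flatten_word v) (flatten_word v') ->
  flat_class v = flat_class v'.
Proof.
by move=> dv dv' vv'; apply: (flat_class_equiv (dv := dv) (dv' := dv'));
  apply: rst_step; constructor 1.
Qed.

Lemma smooth_gauss w x : gauss_word w -> x \in w ->
  gauss_word (smooth (lab x) w).
Proof.
move=> gw xw; have [y [P [Q [R [yx wE]]]]] := gauss_splits gw xw.
have -> : lab x = lab y by case: yx => ->.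
by rewrite (smoothE gw wE); apply: flip_gauss (smoothing_gauss gw wE).
Qed.

Lemma smooth_diagram K w x : is_diagram K w -> x \in w ->
  is_diagram K (smooth (lab x) w).
Proof.
move=> dw xw; case/and3P: (dw) => gw _ _.
have [y [P [Q [R [yx wE]]]]] := gauss_splits gw xw.
have -> : lab x = lab y by case: yx => ->.
by rewrite (smoothE gw wE); apply: smoothing_diagram dw wE.
Qed.

Lemma flatten_smooth_diagram K w x : is_diagram K w -> x \in w ->
  is_diagram flat_kinds (flatten_word (smooth (lab x) w)).
Proof. by move=> dw xw; apply: flatten_diagram (smooth_diagram dw xw). Qed.

(** The conditions on a move involve only orientations, equality of kinds and being virtual, all of
    which flattening respects. *)
Lemma flatten_move w w' : move w w' -> move (flatten_word w) (flatten_word w').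
Proof.
have V x : is_virtual (flat_letter x) = is_virtual x.
  by rewrite /is_virtual /=; case: x => [[l []] b].
have E : flatten_word = map flat_letter by [].
case.
- move=> x p q; rewrite !E !map_cat /= flat_letter_opp.
  exact: (move1 (flat_letter x)).
- move=> x y b p q r bE kxy nxy; rewrite !E !map_cat /=.
  apply: (@move2 (flat_letter x) (flat_letter y)) => //;
    last by rewrite /knd /= kxy.
  by case: bE => ->; [left|right]; rewrite /= !flat_letter_opp.
- move=> x y z e1 e2 e3 b1 b2 b3 p q r s bE px py pz kxz vxy.
  rewrite !E !map_cat !map_rev.
  apply: (@move3 (flat_letter x) (flat_letter y) (flat_letter z) e1 e2 e3) =>
    //.
  + move: (perm_map (map flat_letter) bE) => /perm_trans; apply.
    by rewrite /= /side; case: (e1); case: (e2); case: (e3);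
      rewrite /= !flat_letter_opp.
  + by rewrite -flat_letter_opp /knd /= -/(knd _) -/(knd _) kxz.
  by rewrite !V.
- move=> x p q vx; rewrite !E /= !map_cat /= flat_letter_opp.
  by apply: (@move_tail (flat_letter x)); rewrite V.
- move=> x p q vx; rewrite !E /= !map_cat /= map_cat /= flat_letter_opp.
  by apply: (@move_head (flat_letter x)); rewrite V.
Qed.

Definition restrict (a : pred nat) (w : word) : word :=
  [seq x <- w | a (lab x)].

Lemma flatten_restrict a w : flatten_word (restrict a w) =
  restrict a (flatten_word w).
Proof. by rewrite /restrict filter_map. Qed.

Lemma restrict_gauss a w : gauss_word w -> gauss_word (restrict a w).
Proof. exact: gauss_filter. Qed.

Lemma flip_restrict (a : pred nat) Q x : a (lab x) -> flip (restrict a Q) x =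
  flip Q x.
Proof.
move=> ax; rewrite /flip; congr (_, _ (+) (_ == _)).
rewrite /restrict -[[seq z <- _ | _]]/([seq z <- Q | preim lab a z])
  -filter_map count_filter.
by apply: eq_count => l /=; case: eqP => // ->.
Qed.

(** How often [Q] visits a kept double point is unaffected by deleting other labels. Hence a
    deleting move can be carried through a smoothing. *)
Lemma smooth_restrict (a : pred nat) w x : gauss_word w -> x \in w ->
  a (lab x) ->
  smooth (lab x) (restrict a w) = restrict a (smooth (lab x) w).
Proof.
move=> gw xw; have [y [P [Q [R [yx wE]]]]] := gauss_splits gw xw.
have -> : lab x = lab y by case: yx => ->.
move=> ay; rewrite (smoothE gw wE).
have rE : restrict a w = restrict a P ++ y :: restrict a Q ++
  opp y :: restrict a R.
  by rewrite wE /restrict !(filter_cat, filter_rcons) /= ay filter_cat /= ay.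
rewrite (smoothE (restrict_gauss a gw) rE) /restrict filter_map !filter_cat
  filter_rev.
rewrite -[RHS]/(map (flip Q)
  (restrict a P ++ rev (restrict a Q) ++ restrict a R)).
apply/eq_in_map => z; rewrite !mem_cat mem_rev !mem_filter => za.
by apply: flip_restrict; case/or3P: za => /andP[].
Qed.

(* Words are cut into chunks: the two-letter factors named by a move, and single
   letters.  As reversal fixes the latter,
     the third move reverses every chunk. *)
Definition big (b : word) : bool := 1 < size b.

Lemma smallW b : ~~ big b -> rev b = b.
Proof. by rewrite /big; case: b => [|x [|]]. Qed.

Lemma small_rev W : filter big W = [::] -> map rev W = W.
Proof.
move/eqP; rewrite -[_ == _]negbK -has_filter -all_predC => /allP sW.
by rewrite -[RHS]map_id; apply/eq_in_map => b /sW /smallW.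
Qed.

Lemma big_split W b l : filter big W = b :: l ->
  exists P W', [/\ W = P ++ b :: W', filter big P = [::] & filter big W' = l].
Proof.
elim: W => //= c W IHW; case: ifP => [_ [-> <-]|sc /IHW[P [W' [-> fP fW']]]].
  by exists [::], W.
by exists (c :: P), W'; rewrite /= sc.
Qed.

Lemma big_seq1 p : filter big [seq [:: x] | x <- p] = [::].
Proof. by elim: p. Qed.

Lemma filter_big_rev (W : seq word) : filter big (map rev W) =
  map rev (filter big W).
Proof. by rewrite filter_map; congr map; apply: eq_filter => b;
  rewrite /= /big size_rev. Qed.

Lemma filter_big_map (m : letter -> letter) (W : seq word) :
  filter big (map (map m) W) = map (map m) (filter big W).
Proof. by rewrite filter_map; congr map; apply: eq_filter => b;
  rewrite /= /big size_map. Qed.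

(** A crossing whose label avoids the big chunks has its two passages as chunks of their own, so
    smoothing it cuts no big chunk. *)
Lemma chunk_splits W x : gauss_word (flatten W) -> x \in flatten W ->
    (forall b z, b \in filter big W -> z \in b -> lab z != lab x) ->
  exists y P Q R, (y = x \/ y = opp x) /\ W = P ++ [:: y] :: Q ++
    [:: opp y] :: R.
Proof.
move=> gW xW fresh.
have sing z : z \in flatten W -> lab z = lab x -> [:: z] \in W.
  case/flattenP=> b bW zb lzx; case: (boolP (big b)) => bb.
    by have := fresh b z; rewrite mem_filter bb bW lzx eqxx => /(_ isT zb).
  by case: b zb bb bW => [|z' [|]] //=; rewrite inE => /eqP->.
have := sing _ xW erefl; have := sing (opp x);
  rewrite (gauss_opp _ gW) xW => /(_ isT erefl) oW xW1.
move: oW; case/splitPr: xW1 => P R;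
  rewrite mem_cat inE => /orP[/splitPr[P1 P2]|/orP[|/splitPr[P1 P2]]].
- exists (opp x), P1, P2, R; rewrite oppK -catA; split; [by right|by []].
- by rewrite eqseq_cons andbT (negPf (opp_neq x)).
by exists x, P, P1, P2; split; [left|].
Qed.

Definition flat_flip (Q : word) (x : letter) : letter := flat_letter (flip Q x).

Lemma flat_flip_opp Q x : flat_flip Q (opp x) = opp (flat_flip Q x).
Proof. by rewrite /flat_flip flip_opp flat_letter_opp. Qed.

Lemma flip_eq Q1 Q2 z : count_mem (lab z) (map lab Q1) =
  count_mem (lab z) (map lab Q2) ->
  flip Q1 z = flip Q2 z.
Proof. by rewrite /flip => ->. Qed.

Lemma flip_perm (Q Q' : word) : perm_eq Q Q' -> flip Q =1 flip Q'.
Proof.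
move=> QQ' x; apply: flip_eq.
exact: (permP (perm_map lab QQ')) (pred1 (lab x)).
Qed.

Lemma flatten_cons (b : word) W : flatten (b :: W) = b ++ flatten W.
Proof. by []. Qed.

Lemma perm_flatten_rev (W : seq word) : perm_eq (flatten (map rev W))
  (flatten W).
Proof. by elim: W => //= b W IHW; apply: perm_cat => //; rewrite perm_rev. Qed.

Lemma flatten_flip Q t : flatten_word (map (flip Q) t) = map (flat_flip Q) t.
Proof. by rewrite /flatten_word -map_comp. Qed.

(** * Smoothing a word cut into chunks *)

Section ChunkSmoothing.

Variables (W P Q R : seq word) (u : letter).
Hypothesis gW : gauss_word (flatten W).
Hypothesis WE : W = P ++ [:: u] :: Q ++ [:: opp u] :: R.

Let fWE : flatten W = flatten P ++ u :: flatten Q ++ opp u :: flatten R.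
Proof. by rewrite WE !(flatten_cat, flatten_cons). Qed.

Definition smoothed_chunks : seq word := P ++ rev (map rev Q) ++ R.

Lemma chunk_smooth : flatten_word (smooth (lab u) (flatten W)) =
  flatten (map (map (flat_flip (flatten Q))) smoothed_chunks).
Proof.
rewrite (smoothE gW fWE) -map_flatten /smoothed_chunks !flatten_cat
  -rev_flatten.
by rewrite /flatten_word -map_comp.
Qed.

(** Reversing every chunk commutes with smoothing: [flip] only counts labels in [Q], whatever their
    order. *)
Lemma chunk_smooth_rev : flatten_word (smooth (lab u) (flatten (map rev W))) =
  flatten (map rev (map (map (flat_flip (flatten Q))) smoothed_chunks)).
Proof.
have fE : flatten (map rev W) =
    flatten (map rev P) ++ u :: flatten (map rev Q) ++
      opp u :: flatten (map rev R).
  by rewrite WE !(map_cat, map_cons, flatten_cat, flatten_cons).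
rewrite (smoothE _ fE); last by rewrite (perm_gauss (perm_flatten_rev W)).
have -> (mm : letter -> letter) (V : seq word) : map rev (map (map mm) V) =
  map (map mm) (map rev V).
  by rewrite -!map_comp; apply: eq_map => b /=; rewrite map_rev.
have e x : (flat_letter \o flip (flatten (map rev Q))) x =
  flat_flip (flatten Q) x.
  by rewrite /= (flip_perm (perm_flatten_rev Q)).
rewrite /flatten_word -map_comp (eq_map e) -map_flatten; congr map.
by rewrite /smoothed_chunks !map_cat map_rev !flatten_cat rev_flatten.
Qed.

Let disjointQ z : z \in flatten Q ->
  (z \notin flatten P) && (z \notin flatten R).
Proof. by have := smoothing_disjoint gW fWE; apply. Qed.

(** A big chunk lies entirely inside or entirely outside the reversed part, so its letters are
    turned together. *)
Lemma chunk_mem b z : b \in W -> big b -> z \in b ->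
  (z \in flatten Q) = has (mem (flatten Q)) b.
Proof.
move=> bW bb zb; apply/idP/hasP => [zQ|[z' z'b /= z'Q]]; first by exists z.
have memf (V : seq word) y : y \in b -> b \in V -> y \in flatten V.
  by move=> yb bV; apply/flattenP; exists b.
move: bW; rewrite WE mem_cat inE mem_cat inE.
have [z'P z'R] := andP (disjointQ z'Q).
case/or4P=> [bP|/eqP bu|/(memf _ _ zb) //|].
- by rewrite (memf _ _ z'b bP) in z'P.
- by rewrite bu in bb.
case/orP=> [/eqP bu|bR]; first by rewrite bu in bb.
by rewrite (memf _ _ z'b bR) in z'R.
Qed.

Definition turn_chunk (b : word) : word :=
  map (flat_flip (flatten Q)) (if has (mem (flatten Q)) b then rev b else b).

(** Only up to permutation, as the chunks of [Q] come out in the opposite order. *)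
Lemma big_smoothed :
  perm_eq (filter big (map (map (flat_flip (flatten Q))) smoothed_chunks))
          (map turn_chunk (filter big W)).
Proof.
rewrite filter_big_map /smoothed_chunks WE !filter_cat /= filter_cat filter_rev.
rewrite filter_big_rev /=.
have PR (V : seq word) : {subset V <= P ++ R} ->
  map (map (flat_flip (flatten Q))) (filter big V) =
  map turn_chunk (filter big V).
  move=> VP; apply/eq_in_map => b; rewrite mem_filter => /andP[bb /VP bV].
  rewrite /turn_chunk ifN //; apply/hasPn => z zb; apply/negP => /= zQ.
  have [zP zR] := andP (disjointQ zQ).
  by move: bV; rewrite mem_cat => /orP[] bV; [move: zP|move: zR]; apply/negP;
    rewrite negbK; apply/flattenP; exists b.
rewrite !map_cat PR; last by move=> b bP; rewrite mem_cat bP.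
rewrite (PR R); last by move=> b bR; rewrite mem_cat bR orbT.
rewrite perm_cat2l perm_cat2r map_rev perm_rev -map_comp.
have -> : map (map (flat_flip (flatten Q)) \o rev) (filter big Q) =
  map turn_chunk (filter big Q); last exact: perm_refl.
apply/eq_in_map => b; rewrite mem_filter /big => /andP[bb bQ].
rewrite /turn_chunk ifT //; case: b bb bQ => // z b _ bQ /=.
by apply/orP; left; apply/flattenP; exists (z :: b); rewrite // mem_head.
Qed.

Lemma side_mem e x y : side e x y \in W ->
  (x \in flatten W) * (y \in flatten W) *
    ((y \in flatten Q) = (x \in flatten Q)).
Proof.
move=> sW; have sx : x \in side e x y by case: (e); rewrite !inE eqxx ?orbT.
have sy : y \in side e x y by case: (e); rewrite !inE eqxx ?orbT.
have bs : big (side e x y) by case: (e).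
split; [split|]; try by apply/flattenP; exists (side e x y).
by rewrite !(chunk_mem sW).
Qed.

Lemma turn_side e x y : side e x y \in W ->
  turn_chunk (side e x y) =
  side (e (+) (x \in flatten Q)) (flat_flip (flatten Q) x)
    (flat_flip (flatten Q) y).
Proof.
move=> sW; have sx : x \in side e x y by case: (e); rewrite !inE eqxx ?orbT.
have bs : big (side e x y) by case: (e).
by rewrite /turn_chunk (chunk_mem sW bs sx); case: (has _ _); case: (e).
Qed.

Lemma pos_flat_flip x : x \in flatten W ->
  pos (flat_flip (flatten Q) x) =
  pos x (+) (x \in flatten Q) (+) (opp x \in flatten Q).
Proof. by move=> xW; rewrite /pos /= (smoothing_count gW fWE) // addbA. Qed.

End ChunkSmoothing.

Definition triangle (B : seq word) : Prop :=
  exists x y z e1 e2 e3, perm_eq B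
      [:: side e1 (opp z) x; side e2 (opp x) y; side e3 (opp y) z] /\
    [/\ pos x = (e1 == e2), pos y = (e2 == e3), pos z = (e3 == e1),
       knd x = knd (opp z) & is_virtual x || ~~ is_virtual y].

Lemma triangle_move W : triangle (filter big W) ->
  move (flatten W) (flatten (map rev W)).
Proof.
case=> x [y [z [e1 [e2 [e3 [BE [px py pz kxz vxy]]]]]]].
have [b1 [b2 [b3 bE]]] : exists b1 b2 b3, filter big W = [:: b1; b2; b3].
  have := perm_size BE; case: (filter big W) => [|b1 [|b2 [|b3 []]]] // _.
  by exists b1, b2, b3.
rewrite bE in BE; have [P [W1 [-> sP]]] := big_split bE.
case/big_split=> Q [W2 [-> sQ]]; case/big_split=> R [S [-> sR sS]].
do 3!rewrite map_cat !flatten_cat /=.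
rewrite (small_rev sP) (small_rev sQ) (small_rev sR) (small_rev sS).
exact: (@move3 x y z e1 e2 e3).
Qed.

Lemma restrict_cat a p q : restrict a (p ++ q) = restrict a p ++ restrict a q.
Proof. exact: filter_cat. Qed.

Lemma restrict_idP (a : pred nat) (p : word) : {in p, forall z, a (lab z)} ->
  restrict a p = p.
Proof. by move=> ap; apply/all_filterP/allP. Qed.

Lemma monogon_move W x e : gauss_word (flatten W) ->
    filter big W = [:: side e x (opp x)] ->
  move (flatten W) (restrict (fun l => l != lab x) (flatten W)).
Proof.
move=> gW BE.
wlog eT : x e BE / e = true.
  move=> H; case: e BE => BE; first exact: (H x true).
  by apply: (H (opp x) true); rewrite // oppK.
rewrite {e}eT in BE; have [P [Q [WE _ _]]] := big_split BE.
have fWE : flatten W = flatten P ++ [:: x; opp x] ++ flatten Q.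
  by rewrite WE flatten_cat flatten_cons.
have -> : restrict (fun l => l != lab x) (flatten W) = flatten P ++ flatten Q.
  rewrite fWE !restrict_cat /= eqxx !restrict_idP //; move=> z zin;
  apply: (perm_fresh gW (t := flatten P ++ flatten Q));
    rewrite ?mem_cat ?zin ?orbT //;
  by rewrite fWE; apply/permP => b; rewrite !count_cat /= !count_cat; lia.
by rewrite fWE; apply: move1.
Qed.

(** The constructor [Bigon] names its letters by the factor that comes first, in reading order; the
    order of the sides and the direction of the first give four ways to choose the names. *)
Lemma bigon_chunks W x y e1 e2 : gauss_word (flatten W) ->
    perm_eq (filter big W) [:: side e1 x y; side e2 (opp x) (opp y)] ->
    knd x = knd y -> pos x != pos y ->
  bigon (flatten W)
    (restrict (fun l => l \notin [:: lab x; lab y]) (flatten W)).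
Proof.
move=> gW BE kxy nxy.
have [b1 [b2 bE]] : exists b1 b2, filter big W = [:: b1; b2].
  by have := perm_size BE; case: (filter big W) => [|b1 [|b2 []]] // _;
    exists b1, b2.
have [P [W1 [WE _]]] := big_split bE; case/big_split=> Q [R [W1E _ _]].
have fWE : flatten W = flatten P ++ b1 ++ flatten Q ++ b2 ++ flatten R.
  by rewrite WE W1E !(flatten_cat, flatten_cons).
have main x' y' : b1 = [:: x'; y'] -> b2 = [:: opp x'; opp y'] \/ b2 =
  [:: opp y'; opp x'] ->
    knd x' = knd y' -> pos x' != pos y' ->
    [:: lab x'; lab y'] =i [:: lab x; lab y] ->
    bigon (flatten W)
      (restrict (fun l => l \notin [:: lab x; lab y]) (flatten W)).
  move=> b1E b2E k' n' l'; rewrite b1E in fWE.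
  have -> : restrict (fun l => l \notin [:: lab x; lab y]) (flatten W) =
      restrict (fun l => l \notin [:: lab x'; lab y']) (flatten W).
    by apply: eq_filter => z; rewrite l'.
  by rewrite /restrict -(bigon_filter fWE b2E gW) fWE; apply: Bigon.
have b12 : (b1 == side e1 x y) && (b2 == side e2 (opp x) (opp y)) ||
           (b2 == side e1 x y) && (b1 == side e2 (opp x) (opp y)).
  have := perm_mem BE b1; have := perm_mem BE b2;
    have := perm_mem BE (side e1 x y).
  have := perm_mem BE (side e2 (opp x) (opp y)).
  rewrite bE !inE !eqxx ?orbT /= ?(eq_sym _ b1) ?(eq_sym _ b2).
  by case: eqP; case: eqP; case: eqP; case: eqP.
have ko a b : knd a = knd b -> knd (opp a) =
  knd (opp b) by move/(congr1 opp_kind).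
have po a b : pos a != pos b -> pos (opp a) != pos (opp b).
  by rewrite !pos_opp; case: (pos a); case: (pos b).
have swapl a b : [:: a; b] =i [:: b; a] by move=> l; rewrite !inE orbC.
case/orP: b12 => /andP[/eqP E1 /eqP E2].
  case: e1 E1 {BE} => /= E1; [apply: (main x y)|apply: (main y x)] => //;
    try by rewrite eq_sym.
  - by rewrite E2; case: (e2); [left|right].
  by rewrite E2; case: (e2); [right|left].
case: e2 E2 {BE} => /= E2;
  [apply: (main (opp x) (opp y))|apply: (main (opp y) (opp x))] => //;
  rewrite ?oppK.
- by rewrite E1; case: (e1); [left|right].
- exact: ko.
- exact: po.
- by rewrite E1; case: (e1); [right|left].
- exact/ko.
by apply: po; rewrite eq_sym.
Qed.

Lemma is_virtual_flat_flip Q x : is_virtual (flat_flip Q x) = is_virtual x.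
Proof. by case: x => [[l []] b]. Qed.

Lemma knd_flat_flip Q x : knd (flat_flip Q x) = flatten_kind (knd x).
Proof. by []. Qed.

(** Smoothing reverses the sides lying in [Q]. At each vertex, [pos] and the equality of the
    directions of the two sides change together, so the equations of the triangle persist. *)
Lemma smooth_triangle W u : gauss_word (flatten W) -> triangle (filter big W) ->
    u \in flatten W ->
    (forall b z, b \in filter big W -> z \in b -> lab z != lab u) ->
  move (flatten_word (smooth (lab u) (flatten W)))
       (flatten_word (smooth (lab u) (flatten (map rev W)))).
Proof.
move=> gW tri uW /(chunk_splits gW uW)[v [P [Q [R [vu WE]]]]].
have -> : lab u = lab v by case: vu => ->.
rewrite (chunk_smooth gW WE) (chunk_smooth_rev gW WE); apply: triangle_move.
case: tri => x [y [z [e1 [e2 [e3 [BE [px py pz kxz vxy]]]]]]].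
have inW b : b \in [:: side e1 (opp z) x; side e2 (opp x) y; side e3 (opp y) z]
  -> b \in W.
  by rewrite -(perm_mem BE) mem_filter => /andP[].
have W1 : side e1 (opp z) x \in W by apply: inW; rewrite inE eqxx.
have W2 : side e2 (opp x) y \in W by apply: inW; rewrite !inE eqxx orbT.
have W3 : side e3 (opp y) z \in W by apply: inW; rewrite !inE eqxx !orbT.
have [[_ xW] q1] := side_mem gW WE W1.
have [[_ yW] q2] := side_mem gW WE W2.
have [[_ zW] q3] := side_mem gW WE W3.
pose m := flat_flip (flatten Q).
exists (m x), (m y), (m z), (e1 (+) (x \in flatten Q)),
  (e2 (+) (y \in flatten Q)), (e3 (+) (z \in flatten Q)).
split.
  apply: perm_trans (big_smoothed gW WE) _.
  apply: perm_trans (perm_map _ BE) _.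
  rewrite /= (turn_side gW WE W1) (turn_side gW WE W2) (turn_side gW WE W3).
  by rewrite -!flat_flip_opp q1 q2 q3.
rewrite !(pos_flat_flip gW WE) // !is_virtual_flat_flip -q2 -q3 -q1
  -flat_flip_opp px py pz; split=> //.
- by case: e1 e2 (x \in _) (y \in _) {px py pz BE inW W1 W2 W3} => [] [] [] [].
- by case: e2 e3 (y \in _) (z \in _) {px py pz BE inW W1 W2 W3} => [] [] [] [].
- by case: e3 e1 (z \in _) (x \in _) {px py pz BE inW W1 W2 W3} => [] [] [] [].
by rewrite !knd_flat_flip kxz.
Qed.

Lemma smooth_monogon W x e u : gauss_word (flatten W) ->
    filter big W = [:: side e x (opp x)] -> u \in flatten W -> lab u != lab x ->
  move (flatten_word (smooth (lab u) (flatten W)))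
       (flatten_word (smooth (lab u)
         (restrict (fun l => l != lab x) (flatten W)))).
Proof.
move=> gW BE uW ux; rewrite smooth_restrict // flatten_restrict.
have fresh b z : b \in filter big W -> z \in b -> lab z != lab u.
  rewrite BE inE => /eqP->; rewrite (eq_sym _ (lab u)).
  by case: (e); rewrite !inE => /orP[] /eqP->.
have [v [P [Q [R [vu WE]]]]] := chunk_splits gW uW fresh.
have luv : lab u = lab v by case: vu => ->.
have sW : side e x (opp x) \in W.
  by have : side e x (opp x) \in filter big W;
    [rewrite BE inE|rewrite mem_filter => /andP[]].
have gS := flatten_gauss (smooth_gauss gW uW).
move: gS; rewrite luv (chunk_smooth gW WE) => gS.
pose m := flat_flip (flatten Q).
rewrite -[lab x]/(lab (m x)).
apply: (monogon_move (e := e (+) (x \in flatten Q))) => //.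
apply: perm_small_eq => //; apply: perm_trans (big_smoothed gW WE) _.
by rewrite BE /= (turn_side gW WE sW) flat_flip_opp.
Qed.

Lemma restrict_perm w x t : gauss_word w -> perm_eq w (x :: opp x :: t) ->
  restrict (fun l => l != lab x) t = t.
Proof. by move=> gw wt; apply: restrict_idP; apply: perm_fresh gw wt. Qed.

Lemma tail_move w x t : gauss_word w -> w = x :: t -> is_virtual x ->
  move w (restrict (fun l => l != lab x) w).
Proof.
move=> gw wE vx; rewrite {w}wE in gw *.
have : opp x \in x :: t by rewrite (gauss_opp _ gw) mem_head.
rewrite inE (negPf (opp_neq x)) /= => /splitPr tE.
case: tE gw => p q gw; rewrite /= eqxx restrict_cat /= eqxx -restrict_cat.
rewrite (restrict_perm gw); first exact: move_tail.
by apply/permP => a /=; rewrite !count_cat /=; lia.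
Qed.

Lemma head_move w x t : gauss_word w -> w = rcons t x -> is_virtual x ->
  move w (restrict (fun l => l != lab x) w).
Proof.
move=> gw wE vx; rewrite {w}wE in gw *.
have : opp x \in rcons t x by rewrite (gauss_opp _ gw) mem_rcons mem_head.
rewrite mem_rcons inE (negPf (opp_neq x)) /= => /splitPr tE.
case: tE gw => p q; rewrite -cats1 -catA => gw; rewrite restrict_cat.
have -> : restrict (fun l => l != lab x) (opp x :: q ++ [:: x]) =
  restrict (fun l => l != lab x) q.
  by rewrite /= eqxx restrict_cat /= eqxx cats0.
rewrite -restrict_cat (restrict_perm gw); first exact: move_head.
by apply/permP => a /=; rewrite !count_cat /= count_cat /=; lia.
Qed.

(** The first letter belongs to [P], which is not reversed, so it remains next to the tail. *)
Lemma smooth_tail w x t u : gauss_word w -> w = x :: t -> is_virtual x ->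
    u \in w -> lab u != lab x ->
  move (flatten_word (smooth (lab u) w))
       (flatten_word (smooth (lab u) (restrict (fun l => l != lab x) w))).
Proof.
move=> gw wE vx uw ux; rewrite smooth_restrict // flatten_restrict.
have gS := flatten_gauss (smooth_gauss gw uw).
have [v [P [Q [R [vu vE]]]]] := gauss_splits gw uw.
have luv : lab u = lab v by case: vu => ->.
move: gS; rewrite luv (smoothE gw vE) => gS.
case: P => [|x' P] in vE gS *; first by move: ux; rewrite luv; move: vE;
  rewrite wE => -[->]; rewrite eqxx.
have -> : lab x = lab (flat_flip Q x') by move: vE; rewrite wE => -[->].
apply: (tail_move gS) => //; rewrite is_virtual_flat_flip.
by move: vE; rewrite wE => -[<-].
Qed.

Lemma smooth_head w x t u : gauss_word w -> w = rcons t x -> is_virtual x ->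
    u \in w -> lab u != lab x ->
  move (flatten_word (smooth (lab u) w))
       (flatten_word (smooth (lab u) (restrict (fun l => l != lab x) w))).
Proof.
move=> gw wE vx uw ux; rewrite smooth_restrict // flatten_restrict.
have gS := flatten_gauss (smooth_gauss gw uw).
have [v [P [Q [R [vu vE]]]]] := gauss_splits gw uw.
have luv : lab u = lab v by case: vu => ->.
move: gS; rewrite luv (smoothE gw vE).
case/lastP: R => [|R x'] in vE *.
  move: ux; rewrite luv; move: vE; rewrite wE -cat_cons catA cats1.
  by case/rcons_inj=> _ ->; rewrite lab_opp eqxx.
move: vE; rewrite wE -rcons_cons -rcons_cat -rcons_cons -rcons_cat.
case/rcons_inj=> _ <-.
rewrite -!rcons_cat map_rcons /flatten_word map_rcons => gS.
have -> : lab x = lab (flat_flip Q x) by [].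
by apply: (head_move gS erefl); rewrite is_virtual_flat_flip.
Qed.

(** Each side is turned as a whole, so [pos] is flipped at both [x] and [y] or at neither, and stays
    different. *)
Lemma smooth_bigon W x y e1 e2 u : gauss_word (flatten W) ->
    perm_eq (filter big W) [:: side e1 x y; side e2 (opp x) (opp y)] ->
    knd x = knd y -> pos x != pos y ->
    u \in flatten W -> lab u \notin [:: lab x; lab y] ->
  bigon (flatten_word (smooth (lab u) (flatten W)))
    (flatten_word (smooth (lab u)
      (restrict (fun l => l \notin [:: lab x; lab y]) (flatten W)))).
Proof.
move=> gW BE kxy nxy uW ux; rewrite smooth_restrict // flatten_restrict.
have gS : gauss_word (flatten_word (smooth (lab u) (flatten W))).
  exact: flatten_gauss (smooth_gauss gW uW).
have fresh b z : b \in filter big W -> z \in b -> lab z != lab u.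
  move=> bW zb; apply: contraNneq ux => <-; move: bW; rewrite (perm_mem BE).
  by rewrite !inE => /orP[] /eqP bE; move: zb; rewrite bE;
    [case: (e1)|case: (e2)];
    rewrite !inE => /orP[] /eqP->; rewrite ?lab_opp eqxx ?orbT.
have [v [P [Q [R [vu WE]]]]] := chunk_splits gW uW fresh.
have luv : lab u = lab v by case: vu => ->.
have inW b : b \in [:: side e1 x y; side e2 (opp x) (opp y)] -> b \in W.
  by rewrite -(perm_mem BE) mem_filter => /andP[].
have W1 : side e1 x y \in W by apply: inW; rewrite inE eqxx.
have W2 : side e2 (opp x) (opp y) \in W by apply: inW; rewrite !inE eqxx orbT.
have [[xW yW] q1] := side_mem gW WE W1.
have [[_ _] q2] := side_mem gW WE W2.
move: gS; rewrite luv (chunk_smooth gW WE) => gS.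
pose m := flat_flip (flatten Q).
rewrite -[lab x]/(lab (m x)) -[lab y]/(lab (m y)).
apply: (bigon_chunks (e1 := e1 (+) (x \in flatten Q))
  (e2 := e2 (+) (opp x \in flatten Q))) => //.
- apply: perm_trans (big_smoothed gW WE) _.
  apply: perm_trans (perm_map _ BE) _.
  rewrite /= (turn_side gW WE W1) (turn_side gW WE W2).
  by rewrite -!flat_flip_opp.
- by rewrite !knd_flat_flip kxy.
rewrite !(pos_flat_flip gW WE) // q1 q2; move: nxy.
by case: (pos x) (pos y) (x \in flatten Q) (opp x \in flatten Q) => [] [] [] [].
Qed.

(** * Smoothing a vertex of the triangle *)

Lemma map_flatten_rev (f g : letter -> letter) (V : seq word) :
    {in V, forall c, map f c = map g (rev c)} ->
  map f (flatten V) = map g (flatten (map rev V)).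
Proof.
move=> fg; rewrite !map_flatten -map_comp; congr flatten.
exact/eq_in_map.
Qed.

Definition swap_labels (i j k : nat) : nat :=
  if k == i then j else if k == j then i else k.

Lemma swap_labelsK i j : involutive (swap_labels i j).
Proof.
move=> k; rewrite /swap_labels; case: (eqVneq k i) => [->|ki].
  by rewrite eqxx; case: eqP.
case: (eqVneq k j) => [->|kj]; first by rewrite eqxx.
by rewrite (negPf ki) (negPf kj).
Qed.

Definition relabel (s : nat -> nat) (x : letter) : letter :=
  (s (lab x), knd x, pos x).

(* X is the smoothed vertex, a and b are the other letters of the two sides that
   meet there, and C is the opposite side.  Up to exchanging the two words of
     the
   move, the first side through X ends at X. *)
Section OwnCrossing.

Variables (P Q R : seq word) (a b X : letter) (eta th : bool).
Let C : word := side th (opp b) (opp a).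
Hypothesis bigC : filter big P ++ filter big Q ++ filter big R = [:: C].
Definition own_chunks : seq word := P ++ [:: a; X] :: Q ++
  side eta b (opp X) :: R.
Let W := own_chunks.
Variable K : pred kind.
Hypothesis dW : is_diagram K (flatten W).
Hypothesis dW' : is_diagram K (flatten (map rev W)).
Hypothesis pab : pos a (+) pos b = ~~ eta.
Hypothesis kab : flatten_kind (knd a) = flatten_kind (knd b).

Let gW : gauss_word (flatten W). Proof. by case/and3P: dW. Qed.
Let gW' : gauss_word (flatten (map rev W)). Proof. by case/and3P: dW'. Qed.

(** The three big chunks already use both passages of [a], [b] and [X], so no single-letter chunk
    carries the label of [a] or [b]. *)
Let fresh : lab a != lab b /\
  {in P ++ Q ++ R, forall c, c = C \/
      ~~ big c /\ {in c, forall z, lab z != lab a /\ lab z != lab b}}.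
Proof.
pose S := filter (predC big) (P ++ Q ++ R).
have bigPQR : filter big (P ++ Q ++ R) = [:: C] by rewrite !filter_cat.
have perm_a : perm_eq (flatten W)
  (a :: opp a :: b :: opp b :: X :: opp X :: flatten S).
  have WP : perm_eq W ([:: a; X] :: side eta b (opp X) :: P ++ Q ++ R).
    by apply/permP => f; rewrite /W /own_chunks !count_cat /= !count_cat /=;
      lia.
  apply: perm_trans (perm_flatten WP) _.
  have := perm_flatten (permEl (perm_filterC big (P ++ Q ++ R))).
  rewrite bigPQR -/S /= => /permP h; apply/permP => f; rewrite /= !count_cat -h.
  rewrite count_cat /C.
  case: (eta); case: (th) => /=; move: (f a : nat) (f X : nat) (f b : nat)
    (f (opp X) : nat) (f (opp a) : nat) (f (opp b) : nat) (count f _); clear;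
      lia.
have perm_b : perm_eq (flatten W)
  (b :: opp b :: a :: opp a :: X :: opp X :: flatten S).
  by apply: perm_trans perm_a _;
    rewrite (perm_catCA [:: a; opp a] [:: b; opp b]).
have fa := perm_fresh gW perm_a; have fb := perm_fresh gW perm_b.
split; first by rewrite eq_sym fa ?mem_head.
move=> c cV; case: (boolP (big c)) => bc.
  by left; have := mem_filter big c (P ++ Q ++ R);
    rewrite bigPQR bc cV inE => /eqP.
right; split=> // z zc; have zS : z \in flatten S.
  by apply/flattenP; exists c; rewrite // mem_filter /= bc.
by rewrite fa ?fb // !inE zS !orbT.
Qed.

Let lab_ab : lab a != lab b. Proof. by case: fresh. Qed.

Let in_part V z : {subset V <= P ++ Q ++ R} -> lab z = lab a \/ lab z = lab b ->
  (z \in flatten V) = (z \in C) && (C \in V).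
Proof.
move=> VP lz; apply/flattenP/andP => [[c cV zc]|[zC CV]]; last by exists C.
case: fresh => _ /(_ c (VP c cV)) [cC|[_ /(_ z zc)[za zb]]];
  first by rewrite -cC.
by case: lz => lz; rewrite lz eqxx in za zb.
Qed.

Let QPR : {subset Q <= P ++ Q ++ R}.
Proof. by move=> c cQ; rewrite !mem_cat cQ orbT. Qed.

Let mem_C z : z \in C = (z == opp a) || (z == opp b).
Proof. by rewrite /C; case: (th); rewrite !inE // orbC. Qed.

Let neq_lab y z : lab y != lab z -> (y == z) = false.
Proof. by apply: contraNF => /eqP->. Qed.

Let a_Q : (a \in flatten Q) = false.
Proof.
by rewrite (in_part QPR) ?mem_C;
  [rewrite eq_sym (negPf (opp_neq a)) (neq_lab (z := opp b))|left].
Qed.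
Let b_Q : (b \in flatten Q) = false.
Proof.
by rewrite (in_part QPR) ?mem_C;
  [rewrite (eq_sym b) (neq_lab (y := opp a)) // eq_sym
  (negPf (opp_neq b))|right].
Qed.
Let oa_Q : (opp a \in flatten Q) = (C \in Q).
Proof. by rewrite (in_part QPR) ?mem_C ?eqxx; [|left]. Qed.
Let ob_Q : (opp b \in flatten Q) = (C \in Q).
Proof. by rewrite (in_part QPR) ?mem_C ?eqxx ?orbT; [|right]. Qed.

Let mem_rev_Q z : (z \in flatten (map rev Q)) = (z \in flatten Q).
Proof. by rewrite (perm_mem (perm_flatten_rev Q)). Qed.

Lemma pos_flat_flip_word w P0 Q0 R0 x y : gauss_word w ->
    w = P0 ++ x :: Q0 ++ opp x :: R0 -> y \in w ->
  pos (flat_flip Q0 y) = pos y (+) (y \in Q0) (+) (opp y \in Q0).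
Proof. by move=> gw wE yw;
  rewrite /pos /= (smoothing_count gw wE) // addbA. Qed.

Let count_rev_Q l : count_mem l (map lab (flatten (map rev Q))) =
  count_mem l (map lab (flatten Q)).
Proof. exact: (permP (perm_map lab (perm_flatten_rev Q))) (pred1 l). Qed.

Let neq_ba : lab b != lab a. Proof. by rewrite eq_sym. Qed.

(** The smoothings read P a rev(Q) b R before the move and P b rev(Q) a R after it, up to reversal
    of chunks; the letters of [C] are exchanged too, so a transposition of the two labels matches
    them. *)
Lemma own_isotopic : eta = false ->
  isotopic (flatten_word (smooth (lab X) (flatten W)))
           (flatten_word (smooth (lab X) (flatten (map rev W)))).
Proof.
move=> eF; have fWE : flatten W = (flatten P ++ [:: a]) ++ X :: flatten Q ++
  opp X :: b :: flatten R.
  by rewrite /W /own_chunks eF !(flatten_cat, flatten_cons) -catA.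
have fWE' : flatten (map rev W) = flatten (map rev P) ++ X ::
    (a :: flatten (map rev Q) ++ [:: b]) ++ opp X :: flatten (map rev R).
  rewrite /W /own_chunks eF map_cat flatten_cat /= map_cat flatten_cat /=.
  by rewrite -catA.
exists (swap_labels (lab a) (lab b)); first exact: can_inj (swap_labelsK _ _).
rewrite (smoothE gW fWE) (smoothE gW' fWE').
set Q2 := a :: _.
rewrite !flatten_flip -map_comp.
pose s := swap_labels (lab a) (lab b).
pose f x := relabel s (flat_flip (flatten Q) x); pose g := flat_flip Q2.
rewrite -[RHS]/(map f _) -/g.
have mem_Q2 z : (z \in Q2) = [|| z == a, z == b | z \in flatten Q].
  by rewrite /Q2 inE mem_cat mem_rev_Q inE [X in _ || X]orbC.
have aW : a \in flatten W by rewrite fWE !mem_cat inE eqxx !orbT.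
have bW : b \in flatten W by rewrite fWE !(mem_cat, inE) eqxx !orbT.
have aW' : a \in flatten (map rev W) by rewrite (perm_mem (perm_flatten_rev W)).
have bW' : b \in flatten (map rev W) by rewrite (perm_mem (perm_flatten_rev W)).
have f_opp z : f (opp z) = opp (f z) by rewrite /f flat_flip_opp.
have g_opp z : g (opp z) = opp (g z) by rewrite /g flat_flip_opp.
have fE z : f z =
  (s (lab z), flatten_kind (knd z), pos (flat_flip (flatten Q) z)) by [].
have gE z : g z = (lab z, flatten_kind (knd z), pos (flat_flip Q2 z)) by [].
have npab : pos b = ~~ pos a by move: pab; rewrite eF; case: (pos a);
  case: (pos b).
(* After the move [a] and [b] both lie in the reversed factor [Q2], which they did not before; this
   extra flip compensates for [pos b = ~~ pos a]. *)
have fa : f a = g b.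
  rewrite fE gE kab (pos_flat_flip_word gW fWE) //
    (pos_flat_flip_word gW' fWE') //.
  rewrite !mem_Q2 a_Q b_Q oa_Q ob_Q /s /swap_labels !eqxx orbT npab.
  rewrite (neq_lab (y := opp b)) ?(negPf (opp_neq b)) //=.
  by case: (pos a); case: (C \in Q).
have fb : f b = g a.
  rewrite fE gE -kab (pos_flat_flip_word gW fWE) //
    (pos_flat_flip_word gW' fWE') //.
  rewrite !mem_Q2 a_Q b_Q oa_Q ob_Q /s /swap_labels !eqxx npab (negPf neq_ba).
  rewrite (neq_lab (y := opp a) (z := b)) ?(negPf (opp_neq a)) //=.
  by case: (pos a); case: (C \in Q).
have part V : {subset V <= P ++ Q ++ R} -> map f (flatten V) =
  map g (flatten (map rev V)).
  move=> VP; apply: map_flatten_rev => c /VP;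
    case: fresh => _ /[apply] -[->|[bc zc]].
    by rewrite /C; case: (th) => /=; rewrite !f_opp !g_opp fa fb.
  rewrite (smallW bc); apply/eq_in_map => z /zc[za zb].
  rewrite /f /flat_flip (flip_eq (Q2 := Q2)); last first.
    rewrite /Q2 /= map_cat count_cat /= count_rev_Q (eq_sym (lab a)) (negPf za).
    rewrite (eq_sym (lab b)) (negPf zb); exact: (esym (addn0 _)).
  by rewrite /relabel /= /s /swap_labels (negPf za) (negPf zb).
rewrite /Q2 rev_cons rev_cat -cats1 !map_cat /= fa fb map_rev -!part //.
- by rewrite map_rev -!catA.
- by move=> c cR; rewrite !mem_cat cR !orbT.
by move=> c cP; rewrite mem_cat cP.
Qed.

Let keep (l : nat) := l \notin [:: lab a; lab b].

Let bigon_part (V1 V2 : seq word) c Q0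
  (v := map (flat_flip Q0) (flatten (V1 ++ [:: a; b] :: V2))) :
    gauss_word v -> filter big (V1 ++ V2) = [:: c] -> c = C \/ c = rev C ->
    pos (flat_flip Q0 a) != pos (flat_flip Q0 b) ->
  bigon v (restrict keep v).
Proof.
move=> gv bigV cC nab; rewrite /v map_flatten in gv *.
have [e2 ce] : exists e2, c = side e2 (opp a) (opp b).
  case: cC => ->; rewrite /C; last by exists th; case: (th).
  by exists (~~ th); case: (th).
apply: (bigon_chunks (x := flat_flip Q0 a) (y := flat_flip Q0 b) (e1 := true)
  (e2 := e2)) => //.
rewrite filter_big_map.
have PE : perm_eq (filter big (V1 ++ [:: a; b] :: V2)) [:: [:: a; b];
  side e2 (opp a) (opp b)].
  rewrite -ce -bigV !filter_cat /= -cat1s perm_catCA; exact: perm_refl.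
have := perm_map (map (flat_flip Q0)) PE.
by case: (e2); rewrite /= !flat_flip_opp.
Qed.

Let bigon_class v : is_diagram flat_kinds (flatten_word v) ->
    bigon (flatten_word v) (restrict keep (flatten_word v)) ->
  flat_class v = flat_class (restrict keep (flatten_word v)).
Proof.
move=> dv bv; have dr := bigon_diagram bv dv; have /and3P[_ _ flat_r] := dr.
by apply: flat_class_move => //; rewrite (flatten_word_id flat_r) //;
  apply: bigon_move.
Qed.

(** Both smoothings make [a] and [b] adjacent, and together with [C] they bound a flat bigon;
    removing it from each leaves the same word. *)
Lemma own_bigon : eta = true ->
  flat_class (smooth (lab X) (flatten W)) =
  flat_class (smooth (lab X) (flatten (map rev W))).
Proof.
move=> eT; pose Q1 := flatten Q ++ [:: b]; pose Q2 := a :: flatten (map rev Q).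
have fWE : flatten W = (flatten P ++ [:: a]) ++ X :: Q1 ++ opp X :: flatten R.
  by rewrite /W /own_chunks eT !(flatten_cat, flatten_cons) -!catA.
have fWE' : flatten (map rev W) = flatten (map rev P) ++ X :: Q2 ++
  opp X :: b :: flatten (map rev R).
  by rewrite /W /own_chunks eT map_cat flatten_cat /= map_cat flatten_cat.
have XW : X \in flatten W by rewrite fWE !(mem_cat, inE) eqxx !orbT.
have XW' : X \in flatten (map rev W) by rewrite (perm_mem (perm_flatten_rev W)).
have dv := flatten_smooth_diagram dW XW;
  have dv' := flatten_smooth_diagram dW' XW'.
pose U1 := P; pose U2 := rev (map rev Q) ++ R.
pose U1' := map rev P ++ rev Q; pose U2' := map rev R.
have vE : flatten_word (smooth (lab X) (flatten W)) =
    map (flat_flip Q1) (flatten (U1 ++ [:: a; b] :: U2)).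
  rewrite (smoothE gW fWE) flatten_flip /U1 /U2 /Q1
    !(flatten_cat, flatten_cons) rev_cat.
  by rewrite rev_flatten -!catA.
have vE' : flatten_word (smooth (lab X) (flatten (map rev W))) =
    map (flat_flip Q2) (flatten (U1' ++ [:: a; b] :: U2')).
  rewrite (smoothE gW' fWE') flatten_flip /U1' /U2' /Q2
    !(flatten_cat, flatten_cons) rev_cons.
  rewrite rev_flatten (mapK (@revK _)).
  by rewrite -cats1 -!catA.
(* Before the move the opposite side is reversed when it lies in [Q]; after the move, when it lies
   in [P] or [R]. *)
have [c [cC bigU]] : exists c, (c = C \/ c = rev C) /\ filter big (U1 ++ U2) =
  [:: c].
  rewrite !filter_cat filter_rev filter_big_rev; move: bigC.
  case: (filter big P) => [|c1 [|]] //=; last first.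
    by case: (filter big Q) => //; case: (filter big R) => // -[->]; exists C;
      split; [left|].
  case: (filter big Q) => [|c1 [|]] //=; first by move=> ->; exists C; split;
    [left|].
  by case: (filter big R) => // -[->]; exists (rev C); split; [right|].
have [c' [cC' bigU']] : exists c,
  (c = C \/ c = rev C) /\ filter big (U1' ++ U2') = [:: c].
  rewrite !filter_cat filter_rev !filter_big_rev; move: bigC.
  case: (filter big P) => [|c1 [|]] //=; last first.
    by case: (filter big Q) => //; case: (filter big R) => // -[->];
      exists (rev C); split; [right|].
  case: (filter big Q) => [|c1 [|]] //=; first by move=> ->; exists (rev C);
    split; [right|].
  by case: (filter big R) => // -[->]; exists C; split; [left|].
have aW : a \in flatten W by rewrite fWE !mem_cat inE eqxx !orbT.
have bW : b \in flatten W by rewrite fWE !(mem_cat, inE) eqxx !orbT.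
have aW' : a \in flatten (map rev W) by rewrite (perm_mem (perm_flatten_rev W)).
have bW' : b \in flatten (map rev W) by rewrite (perm_mem (perm_flatten_rev W)).
have mem_Q1 z : (z \in Q1) = (z == b) || (z \in flatten Q).
  by rewrite /Q1 mem_cat inE orbC.
have mem_Q2 z : (z \in Q2) = (z == a) || (z \in flatten Q).
  by rewrite /Q2 inE mem_rev_Q.
have oab : (opp a == b) = false by apply: neq_lab.
have oba : (opp b == a) = false by apply: neq_lab.
(* Here [pos a = pos b], but exactly one of the two letters lies in the reversed factor, while their
   opposites are both inside or both outside. *)
have n1 : pos (flat_flip Q1 a) != pos (flat_flip Q1 b).
  rewrite !(pos_flat_flip_word gW fWE) // !mem_Q1 a_Q b_Q oa_Q ob_Q eqxx oab.
  rewrite (negPf (opp_neq b)) (neq_lab lab_ab); move: pab; rewrite eT.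
  by case: (pos a); case: (pos b); case: (C \in Q).
have n2 : pos (flat_flip Q2 a) != pos (flat_flip Q2 b).
  rewrite !(pos_flat_flip_word gW' fWE') // !mem_Q2 a_Q b_Q oa_Q ob_Q eqxx oba.
  rewrite (negPf (opp_neq a)) (neq_lab neq_ba); move: pab; rewrite eT.
  by case: (pos a); case: (pos b); case: (C \in Q).
rewrite (bigon_class dv); last first.
  by rewrite vE; apply: bigon_part bigU cC n1; rewrite -vE; case/and3P: dv.
rewrite (bigon_class dv'); last first.
  by rewrite vE'; apply: bigon_part bigU' cC' n2; rewrite -vE'; case/and3P: dv'.
congr flat_class; rewrite vE vE'.
have rm Q0 (t : word) : restrict keep (map (flat_flip Q0) t) =
  map (flat_flip Q0) (restrict keep t).
  by rewrite /restrict filter_map.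
have rab : restrict keep [:: a; b] = [::] by rewrite /= /keep !inE !eqxx ?orbT.
have rC : restrict keep C = [::].
  by rewrite /C /keep; case: (th); rewrite /= !inE !eqxx ?orbT.
have rrev (V : seq word) : {subset V <= P ++ Q ++ R} ->
    restrict keep (flatten (map rev V)) = restrict keep (flatten V).
  move=> VP; rewrite /restrict !filter_flatten -map_comp; congr flatten.
  apply/eq_in_map => z /VP; case: fresh => _ /[apply] -[->|[bz _]] /=.
    by rewrite filter_rev -/(restrict _ _) rC.
  by rewrite (smallW bz).
have RPR : {subset R <= P ++ Q ++ R} by move=> z zR; rewrite !mem_cat zR !orbT.
have PPR : {subset P <= P ++ Q ++ R} by move=> z zP; rewrite mem_cat zP.
have tE : restrict keep (flatten (U1' ++ [:: a; b] :: U2')) =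
  restrict keep (flatten (U1 ++ [:: a; b] :: U2)).
  rewrite /U1 /U2 /U1' /U2' !(flatten_cat, flatten_cons) !restrict_cat rab
    !rrev //.
  rewrite -[rev Q in LHS](_ : rev (map rev (map rev Q)) = _); last first.
    by rewrite (mapK (@revK _)).
  rewrite -!rev_flatten /=.
  have rv t : restrict keep (rev t) =
    rev (restrict keep t) by exact: filter_rev.
  by rewrite !rv rrev // !catA.
rewrite !rm tE; apply/eq_in_map => z; rewrite mem_filter => /andP[kz _].
rewrite /flat_flip; congr flat_letter; apply: flip_eq; move: kz;
  rewrite /keep !inE negb_or => /andP[za zb].
rewrite /Q1 /Q2 map_cat count_cat /= count_rev_Q (eq_sym (lab a)) (negPf za).
by rewrite (eq_sym (lab b)) (negPf zb); exact: addn0.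
Qed.

End OwnCrossing.

Lemma sideN e x y : side (~~ e) x y = side e y x.
Proof. by case: e. Qed.

Lemma rev_side e x y : rev (side e x y) = side (~~ e) x y.
Proof. by case: e. Qed.

Lemma own_class K (P Q R : seq word) a b X e1 e2 th
    (W := P ++ side e1 a X :: Q ++ side e2 b (opp X) :: R) :
    filter big P ++ filter big Q ++ filter big R =
      [:: side th (opp b) (opp a)] ->
    is_diagram K (flatten W) -> is_diagram K (flatten (map rev W)) ->
    pos a (+) pos b = e1 (+) e2 ->
    flatten_kind (knd a) = flatten_kind (knd b) ->
  flat_class (smooth (lab X) (flatten W)) =
  flat_class (smooth (lab X) (flatten (map rev W))).
Proof.
have main P0 Q0 R0 e0 th0
  (W0 := P0 ++ side true a X :: Q0 ++ side e0 b (opp X) :: R0) :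
    filter big P0 ++ filter big Q0 ++ filter big R0 =
      [:: side th0 (opp b) (opp a)] ->
    is_diagram K (flatten W0) -> is_diagram K (flatten (map rev W0)) ->
    pos a (+) pos b = ~~ e0 ->
    flatten_kind (knd a) = flatten_kind (knd b) ->
    flat_class (smooth (lab X) (flatten W0)) =
    flat_class (smooth (lab X) (flatten (map rev W0))).
  move=> bigC dW dW' pab kab; case: e0 => [|] in W0 dW dW' pab *.
    exact: (own_bigon bigC dW dW').
  have XW : X \in flatten W0.
    by apply/flattenP; exists [:: a; X]; rewrite ?mem_cat !inE eqxx ?orbT.
  apply: flat_class_isotopic.
  - exact: flatten_smooth_diagram dW XW.
  - by apply: flatten_smooth_diagram dW' _;
      rewrite (perm_mem (perm_flatten_rev W0)).
  exact: (own_isotopic bigC dW dW').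
move=> bigC dW dW' pab kab; case: e1 => [|] in W dW dW' pab *.
  exact: (main P Q R e2 th).
have WE : map rev W = map rev P ++ side true a X :: map rev Q ++
  side (~~ e2) b (opp X) :: map rev R.
  by rewrite /W map_cat /= map_cat /= rev_side.
have WK : map rev (map rev W) = W by rewrite (mapK (@revK _)).
rewrite -[in LHS]WK WE; apply/esym; apply: (main _ _ _ _ (~~ th));
  rewrite -?WE ?WK //.
- by rewrite !filter_big_rev -!map_cat bigC /= rev_side.
by rewrite negbK.
Qed.

Lemma flatten_kind_opp x : flatten_kind (knd (opp x)) = flatten_kind (knd x).
Proof. by case: x => [[l []] b]. Qed.

(** Without the conditions on kinds, which single out a moving strand, the pattern is cyclically
    symmetric, so treating one vertex covers all three. *)
Definition triangle_of (B : seq word) x y z e1 e2 e3 : Prop :=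
  perm_eq B [:: side e1 (opp z) x; side e2 (opp x) y; side e3 (opp y) z] /\
  [/\ pos x = (e1 == e2), pos y = (e2 == e3) & pos z = (e3 == e1)].

Lemma triangle_of_rot B x y z e1 e2 e3 :
  triangle_of B x y z e1 e2 e3 -> triangle_of B y z x e2 e3 e1.
Proof.
case=> BE [px py pz]; split=> //; apply: perm_trans BE _.
by rewrite perm_sym (perm_catC [:: _; _] [:: _]).
Qed.

(** The two double points on the side opposite to [x] get exchanged or removed as a bigon, hence the
    condition that their flat kinds agree. The cases differ in which side through [x] comes first in
    the word. *)
Lemma triangle_own K W x y z e1 e2 e3 : is_diagram K (flatten W) ->
    is_diagram K (flatten (map rev W)) ->
    triangle_of (filter big W) x y z e1 e2 e3 ->
    flatten_kind (knd y) = flatten_kind (knd z) ->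
  flat_class (smooth (lab x) (flatten W)) =
  flat_class (smooth (lab x) (flatten (map rev W))).
Proof.
move=> dW dW' [BE [px py pz]] kyz.
have := perm_mem BE (side e1 (opp z) x); rewrite inE eqxx mem_filter /=.
case/andP=> b1 /splitPr WE; case: WE => P R in dW dW' BE *.
have {}BE : perm_eq (filter big P ++ filter big R) [:: side e2 (opp x) y;
  side e3 (opp y) z].
  by rewrite -(perm_cons (side e1 (opp z) x)); move: BE;
    rewrite filter_cat /= b1 -cat1s perm_catCA.
have kz := flatten_kind_opp z.
have := perm_mem BE (side e2 (opp x) y);
  rewrite inE eqxx mem_cat !mem_filter /=.
have b2 : big (side e2 (opp x) y) by case: (e2).
rewrite b2 /= => /orP[] /splitPr UE.
  case: UE => P1 P2 in dW dW' BE *.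
  have {}BE : filter big P1 ++ filter big P2 ++ filter big R =
    [:: side e3 (opp y) z].
    apply: perm_small_eq => //; rewrite -(perm_cons (side e2 (opp x) y)).
    by move: BE; rewrite filter_cat /= b2 -catA /= -cat1s perm_catCA.
  have WE : (P1 ++ side e2 (opp x) y :: P2) ++ side e1 (opp z) x :: R =
      P1 ++ side (~~ e2) y (opp x) :: P2 ++ side e1 (opp z) (opp (opp x)) :: R.
    by rewrite sideN oppK -catA.
  rewrite WE in dW dW' *; apply: (own_class (th := ~~ e3)) dW dW' _ _.
  - by rewrite sideN oppK.
  - by rewrite pos_opp py pz; case: (e1); case: (e2); case: (e3).
  by rewrite kz.
case: UE => Q S in dW dW' BE *.
have {}BE : filter big P ++ filter big Q ++ filter big S =
  [:: side e3 (opp y) z].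
  apply: perm_small_eq => //; rewrite -(perm_cons (side e2 (opp x) y)).
  by move: BE; rewrite filter_cat /= b2 -cat1s catA perm_catCA -catA.
have WE : P ++ side e1 (opp z) x :: Q ++ side e2 (opp x) y :: S =
    P ++ side e1 (opp z) x :: Q ++ side (~~ e2) y (opp x) :: S.
  by rewrite sideN.
rewrite WE in dW dW' *; apply: (own_class (th := e3)) dW dW' _ _.
- by rewrite oppK.
- by rewrite pos_opp py pz; case: (e1); case: (e2); case: (e3).
by rewrite kz.
Qed.

Local Open Scope ring_scope.

(** The moving strand has the same flat kind at [x] and [z], which settles a smoothing at [y]. At
    [x] or [z] that strand is not virtual, so the exclusion of the forbidden move makes [y]
    non-virtual and all three vertices flat. *)
Lemma triangle_class K W u : is_diagram K (flatten W) ->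
    is_diagram K (flatten (map rev W)) -> triangle (filter big W) ->
    u \in flatten W -> ~~ is_virtual u ->
  flat_class (smooth (lab u) (flatten W)) =
  flat_class (smooth (lab u) (flatten (map rev W))).
Proof.
move=> dW dW' tri uW nvu; case/and3P: (dW) => gW _ _.
have uW' : u \in flatten (map rev W) by rewrite (perm_mem (perm_flatten_rev W)).
case: (tri) => x [y [z [e1 [e2 [e3 [BE [px py pz kxz vxy]]]]]]].
have fk v : ~~ is_virtual v -> flatten_kind (knd v) = Flat.
  by rewrite /is_virtual; case: (knd v).
have vir v : is_virtual (opp v) = is_virtual v by rewrite /is_virtual;
  case: v => [[l []] b].
have nv v : v \in flatten W -> lab u = lab v -> ~~ is_virtual v.
  by move=> vW luv; case: (gauss_same_lab gW uW vW (esym luv)) => ->;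
    rewrite ?vir.
have kz : flatten_kind (knd x) =
  flatten_kind (knd z) by rewrite kxz flatten_kind_opp.
have vz : is_virtual x = is_virtual z by rewrite -(vir z) /is_virtual kxz.
have T1 : triangle_of (filter big W) x y z e1 e2 e3 by [].
have T2 := triangle_of_rot T1; have T3 := triangle_of_rot T2.
have inW b v : b \in [:: side e1 (opp z) x; side e2 (opp x) y;
  side e3 (opp y) z] -> v \in b -> v \in flatten W.
  by rewrite -(perm_mem BE) mem_filter => /andP[_ bW] vb; apply/flattenP;
    exists b.
have xW : x \in flatten W.
  by apply: (inW (side e1 (opp z) x));
    [rewrite !inE eqxx ?orbT | case: (e1); rewrite !inE eqxx ?orbT].
have yW : y \in flatten W.
  by apply: (inW (side e2 (opp x) y));
    [rewrite !inE eqxx ?orbT | case: (e2); rewrite !inE eqxx ?orbT].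
have zW : z \in flatten W.
  by apply: (inW (side e3 (opp y) z));
    [rewrite !inE eqxx ?orbT | case: (e3); rewrite !inE eqxx ?orbT].
case: (eqVneq (lab u) (lab x)) => [lux|nux].
  rewrite lux; apply: (triangle_own dW dW' T1).
  have nvx := nv x xW lux; move: vxy; rewrite (negPf nvx) /= => nvy.
  by rewrite !fk // -vz.
case: (eqVneq (lab u) (lab y)) => [luy|nuy].
  by rewrite luy; apply: (triangle_own dW dW' T2).
case: (eqVneq (lab u) (lab z)) => [luz|nuz].
  rewrite luz; apply: (triangle_own dW dW' T3).
  have nvz := nv z zW luz; rewrite -vz in nvz; move: vxy;
    rewrite (negPf nvz) /= => nvy.
  by rewrite !fk.
apply: flat_class_move.
- exact: flatten_smooth_diagram dW uW.
- exact: flatten_smooth_diagram dW' uW'.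
apply: smooth_triangle => // b v bB vb.
move: bB; rewrite (perm_mem BE) !inE (eq_sym _ (lab u)) => /or3P[] /eqP bE;
  move: vb; rewrite bE;
  [case: (e1) | case: (e2) | case: (e3)]; by rewrite !inE => /orP[] /eqP->.
Qed.

Lemma monogon_own K p x q : is_diagram K (p ++ [:: x; opp x] ++ q) ->
  smooth (lab x) (p ++ [:: x; opp x] ++ q) = p ++ q.
Proof.
case/and3P=> gw _ _; rewrite (smoothE (P := p) (Q := [::]) (R := q) gw) //=.
by rewrite -[RHS]map_id; apply: eq_map => -[[l k] b]; rewrite /flip addbF.
Qed.

Lemma monogon_class K v p x q : is_diagram K v ->
    flatten_word v = p ++ [:: x; opp x] ++ q ->
  flat_class v = flat_class (p ++ q).
Proof.
move=> dv vE; have dfv := flatten_diagram dv; have := dfv; rewrite {1}vE => dpx.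
have fpq : flatten_word (p ++ q) = p ++ q.
  apply: flatten_word_id; case/and3P: dpx => _ _.
  by rewrite !all_cat => /andP[-> /andP[_ ->]].
apply: flat_class_move; rewrite ?fpq //; last by rewrite vE; apply: move1.
(* The word without the monogon is the smoothing at its crossing, and so is planar. *)
rewrite -(monogon_own dpx); apply: smooth_diagram => //.
by rewrite !mem_cat inE eqxx ?orbT.
Qed.

(** For parallel strands each smoothing turns the other crossing into a monogon on p rev(q) r. For
    antiparallel strands the results are p opp(y) rev(q) y r and p x rev(q) opp(x) r, which differ
    by a renaming. *)
Lemma bigon_own K x y b p q r (w := p ++ [:: x; y] ++ q ++ b ++ r) :
    is_diagram K w ->
    b = [:: opp x; opp y] \/ b = [:: opp y; opp x] ->
    knd x = knd y -> pos x != pos y ->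
  flat_class (smooth (lab x) w) = flat_class (smooth (lab y) w).
Proof.
move=> dw bE kxy nxy; case/and3P: (dw) => gw _ _.
have wt := bigon_perm p q r bE.
have wt' : perm_eq w (y :: opp y :: x :: opp x :: p ++ q ++ r).
  by apply: perm_trans wt _; rewrite (perm_catCA [:: x; opp x] [:: y; opp y]).
have fx := perm_fresh gw wt; have fy := perm_fresh gw wt'.
have {}fx z : z \in p ++ q ++ r -> lab z != lab x by move=> zt; apply: fx;
  rewrite !inE zt !orbT.
have {}fy z : z \in p ++ q ++ r -> lab z != lab y by move=> zt; apply: fy;
  rewrite !inE zt !orbT.
have lxy : lab y != lab x by apply: (perm_fresh gw wt); rewrite mem_head.
have xw : x \in w by rewrite (perm_mem wt) !inE eqxx.
have yw : y \in w by rewrite (perm_mem wt) !inE eqxx !orbT.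
have dx := smooth_diagram dw xw; have dy := smooth_diagram dw yw.
case: bE => bE.
  have wx : w = p ++ x :: (y :: q) ++ opp x :: (opp y :: r) by rewrite /w bE.
  have wy : w = (p ++ [:: x]) ++ y :: (q ++ [:: opp x]) ++
    opp y :: r by rewrite /w bE -!catA.
  have ex : flatten_word (smooth (lab x) w) =
      map (flat_flip (y :: q)) (p ++ rev q) ++
      [:: flat_flip (y :: q) y; opp (flat_flip (y :: q) y)] ++
        map (flat_flip (y :: q)) r.
    by rewrite (smoothE gw wx) flatten_flip rev_cons -cats1 -flat_flip_opp
      !map_cat -!catA.
  have ey : flatten_word (smooth (lab y) w) =
      map (flat_flip (q ++ [:: opp x])) p ++
      [:: flat_flip (q ++ [:: opp x]) x; opp (flat_flip (q ++ [:: opp x]) x)]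
        ++ map (flat_flip (q ++ [:: opp x])) (rev q ++ r).
    by rewrite (smoothE gw wy) flatten_flip rev_cat -flat_flip_opp !map_cat
      -!catA.
  rewrite (monogon_class dx ex) (monogon_class dy ey); congr flat_class.
  rewrite !map_cat -!catA -!map_cat; apply/eq_in_map => z zt.
  have {}zt : z \in p ++ q ++ r by move: zt; rewrite !mem_cat mem_rev.
  rewrite /flat_flip; congr flat_letter; apply: flip_eq.
  rewrite map_cat count_cat /= (eq_sym (lab y)) (eq_sym (lab x))
    (negPf (fx z zt)) (negPf (fy z zt)).
  by lia.
have wx : w = p ++ x :: (y :: q ++ [:: opp y]) ++
  opp x :: r by rewrite /w bE /= -!catA.
have wy : w = (p ++ [:: x]) ++ y :: q ++
  opp y :: (opp x :: r) by rewrite /w bE -!catA.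
apply: flat_class_isotopic;
  [exact: flatten_diagram dx|exact: flatten_diagram dy|].
exists (swap_labels (lab x) (lab y)); first exact: can_inj (swap_labelsK _ _).
rewrite (smoothE gw wx) (smoothE gw wy) !flatten_flip -map_comp.
set Q1 := y :: _.
pose f z := relabel (swap_labels (lab x) (lab y)) (flat_flip Q1 z).
rewrite -[RHS]/(map f _).
have f_opp z : f (opp z) = opp (f z) by rewrite /f flat_flip_opp.
have zq : {in q, forall z, lab z != lab x /\ lab z != lab y}.
  by move=> z zq; rewrite fx ?fy // !mem_cat zq orbT.
have c0 l : (forall z, z \in q -> lab z != l) -> count_mem l (map lab q) = 0%N.
  by move=> nl; apply/count_memPn/negP => /mapP[z /nl zl lE];
    rewrite lE eqxx in zl.
have cx : count_mem (lab x) (map lab q) = 0%N by apply: c0 => z /zq[].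
have cy : count_mem (lab y) (map lab q) = 0%N by apply: c0 => z /zq[].
(* Both passages of [y] lie in [Q1], so no flip occurs, and [pos (opp y) = pos x] because the
   orientations at [x] and [y] are opposite. *)
have fyx : f (opp y) = flat_flip q x.
  have fE1 z : f z = (swap_labels (lab x) (lab y) (lab z), flatten_kind (knd z),
    pos z (+) (count_mem (lab z) (map lab Q1) == 1%N)) by [].
  have fE2 z : flat_flip q z = (lab z, flatten_kind (knd z),
    pos z (+) (count_mem (lab z) (map lab q) == 1%N)) by [].
  rewrite f_opp fE1 fE2 /Q1 /= map_cat count_cat /= cx cy eqxx /swap_labels
    eqxx.
  rewrite (negPf lxy) kxy addbF /opp /lab /knd /pos /= -/(pos x) -/(pos y)
    addbF.
  by move: nxy; case: y.1.2; case: (pos x); case: (pos y).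
have fz z : z \in p ++ q ++ r -> f z = flat_flip q z.
  move=> zt; rewrite /f /flat_flip (flip_eq (Q2 := q)).
    by rewrite /relabel /swap_labels /= (negPf (fx z zt)) (negPf (fy z zt)).
  by rewrite /Q1 /= map_cat count_cat /= (eq_sym (lab y)) (negPf (fy z zt))
    !addn0.
have fyy : f y =
  flat_flip q (opp x) by rewrite -[y]oppK f_opp fyx flat_flip_opp.
have part t : {subset t <= p ++ q ++ r} -> map f t = map (flat_flip q) t.
  by move=> ts; apply/eq_in_map => z /ts; apply: fz.
rewrite /Q1 rev_cons rev_cat -cats1 !map_cat /= fyx fyy !part -?catA //.
- by move=> z zr; rewrite !mem_cat zr !orbT.
- by move=> z; rewrite mem_rev => zr; rewrite !mem_cat zr !orbT.
by move=> z zp; rewrite mem_cat zp.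
Qed.

(** * Invariance *)

(** This is the sign of the crossing at an over-passage and its negative at the under-passage;
    defined on all letters, it lets the four letters of a bigon be compared. *)
Definition strand_sign (x : letter) : int := if pos x then 1 else -1.

Definition crossing_term (w : word) (x : letter) : {freeg flat_knotoid / int} :=
  << strand_sign x *g flat_class (smooth (lab x) w) >> -
  << strand_sign x *g flat_class w >>.

Definition word_polynomial (w : word) : {freeg flat_knotoid / int} :=
  \sum_(x <- w | knd x == Over) crossing_term w x.

Lemma freegU_sum (T : choiceType) (I : Type) (r : seq I) (P : pred I)
  (F : I -> int) (k : T) :
  << \sum_(i <- r | P i) F i *g k >> =
    \sum_(i <- r | P i) << F i *g k >> :> {freeg T / int}.
Proof.
apply: (big_morph (fun c : int => << c *g k >> : {freeg T / int})).
  by move=> c c'; rewrite freegUD.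
exact: freegU0.
Qed.

Lemma crossing_signE w x : gauss_word w -> x \in w -> knd x = Over ->
  crossing_sign w (lab x) = strand_sign x.
Proof.
move=> gw xw kx; rewrite /crossing_sign /strand_sign.
have xE : x = (lab x, Over, pos x) by rewrite -kx; case: (x) => [[]].
case: (boolP (pos x)) => px; first by rewrite -px -xE xw.
rewrite ifN //; apply/negP => yw.
case: (gauss_same_lab gw xw yw erefl) => [/(congr1 pos) pE|/(congr1 knd)].
  by move: px; rewrite -pE.
by rewrite [RHS]/(opp_kind (knd x)) kx.
Qed.

Lemma smoothing_polynomialE (D : virtual_knotoid_diagram) :
  smoothing_polynomial D = word_polynomial D.
Proof.
have gD : gauss_word D by case/and3P: (valP D).
rewrite /smoothing_polynomial /word_polynomial /writhe /classical_crossings.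
rewrite !big_map !big_filter freegU_sum -sumrB.
rewrite big_seq_cond [RHS]big_seq_cond; apply: eq_bigr => x /andP[xD /eqP kx].
by rewrite crossing_signE.
Qed.

Lemma word_polynomial_perm w w' : perm_eq w w' ->
    flat_class w = flat_class w' ->
    {in w, forall x, knd x = Over ->
      flat_class (smooth (lab x) w) = flat_class (smooth (lab x) w')} ->
  word_polynomial w = word_polynomial w'.
Proof.
move=> ww' cw cs;
  rewrite /word_polynomial (perm_big w') //= big_seq_cond [RHS]big_seq_cond.
apply: eq_bigr => x /andP[]; rewrite -(perm_mem ww') => xw /eqP kx.
by rewrite /crossing_term cs // cw.
Qed.

(** Covers the moves that delete double points; what is left to check is that the deleted crossings
    contribute 0 in total. *)
Lemma word_polynomial_restrict a w : flat_class w = flat_class (restrict a w) ->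
    {in w, forall x, a (lab x) -> knd x = Over ->
      flat_class (smooth (lab x) w) =
        flat_class (smooth (lab x) (restrict a w))} ->
    \sum_(x <- w | (knd x == Over) && ~~ a (lab x)) crossing_term w x = 0 ->
  word_polynomial w = word_polynomial (restrict a w).
Proof.
move=> cw cs s0;
  rewrite /word_polynomial (bigID (fun x => a (lab x))) /= s0 addr0.
rewrite [RHS]big_filter_cond; rewrite big_seq_cond [RHS]big_seq_cond.
apply: eq_big => [x|x]; first by rewrite [a _ && _]andbC.
by case/and3P=> xw /eqP kx ax; rewrite /crossing_term cs // cw.
Qed.

Lemma flatten_seq1 (p : word) : flatten [seq [:: x] | x <- p] = p.
Proof. by elim: p => //= x p ->. Qed.

Lemma word_polynomial_move K w w' : is_diagram K w -> is_diagram K w' ->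
  move w w' -> word_polynomial w = word_polynomial w'.
Proof.
move=> dw dw' ww'; have cw : flat_class w = flat_class w'.
  by apply: flat_class_move (flatten_move ww'); apply: flatten_diagram;
    eassumption.
have gw : gauss_word w by case/and3P: dw.
have by_restrict a : w' = restrict a w ->
    {in w, forall x, a (lab x) -> move (flatten_word (smooth (lab x) w))
       (flatten_word (smooth (lab x) (restrict a w)))} ->
    \sum_(x <- w | (knd x == Over) && ~~ a (lab x)) crossing_term w x = 0 ->
    word_polynomial w = word_polynomial w'.
  move=> w'E ms s0; rewrite w'E in dw' cw *;
    apply: word_polynomial_restrict => // x xw ax kx.
  apply: flat_class_move; [exact: flatten_smooth_diagram dw xw| |exact: ms].
  by apply: flatten_smooth_diagram dw' _; rewrite mem_filter ax.
(* When the only deleted double point is virtual, no over-passage is deleted and the sum to be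
   checked is empty. *)
have single x : is_virtual x -> x \in w -> w' =
  restrict (fun l => l != lab x) w ->
    {in w, forall u, lab u != lab x -> move (flatten_word (smooth (lab u) w))
       (flatten_word (smooth (lab u) (restrict (fun l => l != lab x) w)))} ->
    word_polynomial w = word_polynomial w'.
  move=> vx xw w'E ms; apply: (by_restrict _ w'E ms).
  apply: big1_seq => u /andP[/andP[/eqP ku]]; rewrite negbK => /eqP lu uw;
    exfalso.
  by move: ku vx; rewrite /is_virtual;
    case: (gauss_same_lab gw xw uw lu) => ->; case: (x) => [[l []] b].
case: ww' => [x p q|x y b p q r bE kxy nxy|x y z e1 e2 e3 b1 b2 b3 p q r s BE
  px py pz kxz vxy|x p q vx|x p q vx]
  in dw dw' cw gw by_restrict single *.
- pose W := [seq [:: z] | z <- p] ++ [:: x; opp x] :: [seq [:: z] | z <- q].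
  have WE : flatten W = p ++ [:: x; opp x] ++ q.
    by rewrite /W flatten_cat flatten_cons !flatten_seq1.
  have bigW : filter big W = [:: side true x (opp x)].
    by rewrite /W filter_cat /= !big_seq1.
  have rE : p ++ q = restrict (fun l => l != lab x) (p ++ [:: x; opp x] ++ q).
    rewrite !restrict_cat /= eqxx cat0s -restrict_cat (restrict_perm gw) //.
    by apply/permP => f; rewrite !count_cat /= !count_cat; lia.
  apply: (by_restrict _ rE).
    by rewrite -WE in gw *; move=> u uw; apply: (smooth_monogon gw bigW uw).
  apply: big1 => u /andP[_]; rewrite negbK => /eqP lu.
  by rewrite /crossing_term lu (monogon_own dw) cw subrr.
- pose W := [seq [:: z] | z <- p] ++ [:: x; y] :: [seq [:: z] | z <- q] ++
    b :: [seq [:: z] | z <- r].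
  have WE : flatten W = p ++ [:: x; y] ++ q ++ b ++ r.
    by rewrite /W !(flatten_cat, flatten_cons) !flatten_seq1.
  have [e2 be2] : exists e2, b = side e2 (opp x) (opp y).
    by case: bE => ->; [exists true|exists false].
  have bigW : perm_eq (filter big W) [:: side true x y;
    side e2 (opp x) (opp y)].
    by rewrite /W filter_cat /= filter_cat /= !big_seq1 be2; case: (e2).
  have rE := bigon_filter erefl bE gw.
  apply: (by_restrict (fun l => l \notin [:: lab x; lab y]) rE).
    rewrite -WE in gw *; move=> u uw lu; apply: bigon_move.
    exact: (smooth_bigon gw bigW kxy nxy uw lu).
  have cs := bigon_own dw bE kxy nxy.
  have opp_sign z : strand_sign (opp z) = - strand_sign z.
    by rewrite /strand_sign pos_opp; case: (pos z); rewrite ?opprK.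
  have sxy : strand_sign y = - strand_sign x.
    by move: nxy; rewrite /strand_sign; case: (pos x); case: (pos y);
      rewrite ?opprK.
  have tO z : crossing_term (p ++ [:: x; y] ++ q ++ b ++ r) (opp z) =
    - crossing_term (p ++ [:: x; y] ++ q ++ b ++ r) z.
    by rewrite /crossing_term opp_sign -!freegUN opprB opprK addrC.
  have txy : crossing_term (p ++ [:: x; y] ++ q ++ b ++ r) y =
    - crossing_term (p ++ [:: x; y] ++ q ++ b ++ r) x.
    by rewrite /crossing_term sxy -cs -!freegUN opprB opprK addrC.
  rewrite (perm_big _ (bigon_perm p q r bE)) /= !big_cons big1_seq; last first.
    by move=> z; rewrite rE mem_filter => /andP[/andP[_ /negPf->]].
  (* As [x] and [y] have equal kinds, the over-passages are [x] and [y], or their opposites, or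
     there are none; the terms cancel in each case. *)
  rewrite !tO txy !lab_opp !inE !eqxx !orbT !andbT.
  rewrite /knd /= -/(knd x) -/(knd y) kxy.
  by case: (knd y); rewrite /= ?addr0 ?opprK ?addrN ?addNr.
- have side_big b : b \in [:: side e1 (opp z) x; side e2 (opp x) y;
    side e3 (opp y) z] -> big b.
    by rewrite !inE => /or3P[] /eqP->; [case: (e1)|case: (e2)|case: (e3)].
  have bB i : i \in [:: b1; b2; b3] -> big i by rewrite (perm_mem BE);
    apply: side_big.
  pose W := [seq [:: v] | v <- p] ++ b1 :: [seq [:: v] | v <- q] ++ b2 ::
    [seq [:: v] | v <- r] ++ b3 :: [seq [:: v] | v <- s].
  have WE : flatten W = p ++ b1 ++ q ++ b2 ++ r ++ b3 ++ s.
    by rewrite /W !(flatten_cat, flatten_cons) !flatten_seq1.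
  have WE' : flatten (map rev W) = p ++ rev b1 ++ q ++ rev b2 ++ r ++ rev b3 ++
    s.
    rewrite /W; do 3!rewrite map_cat !flatten_cat /=.
    by rewrite !(small_rev (big_seq1 _)) !flatten_seq1.
  have tri : triangle (filter big W).
    exists x, y, z, e1, e2, e3; split=> //.
    by rewrite /W; do 3!rewrite filter_cat /= ?bB ?big_seq1 ?inE ?eqxx ?orbT //.
  rewrite -WE -WE' in dw dw' cw gw *; apply: word_polynomial_perm => //.
    by rewrite perm_sym; apply: perm_flatten_rev.
  move=> u uW ku; apply: (triangle_class dw dw' tri uW).
  by rewrite /is_virtual ku.
- have wE : x :: p ++ opp x :: q = x :: (p ++ opp x :: q) by [].
  apply: (single x) => //; first exact: mem_head.
    rewrite /= eqxx restrict_cat /= eqxx -restrict_cat (restrict_perm gw) //.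
    by apply/permP => f; rewrite /= !count_cat /=; lia.
  move=> u uw; exact: smooth_tail gw wE vx uw.
have wE : p ++ opp x :: q ++ [:: x] = rcons (p ++ opp x :: q) x.
  by rewrite -cats1 -catA.
apply: (single x) => //; first by rewrite wE mem_rcons mem_head.
  rewrite restrict_cat /= eqxx restrict_cat /= eqxx cats0 -restrict_cat
    (restrict_perm gw) //.
  by apply/permP => f; rewrite /= !count_cat /= count_cat /=; lia.
move=> u uw; exact: smooth_head gw wE vx uw.
Qed.

Lemma relabel_smooth f w x : injective f -> gauss_word w -> x \in w ->
  smooth (f (lab x)) (map (relabel f) w) = map (relabel f) (smooth (lab x) w).
Proof.
move=> inj_f gw xw; have [y [P [Q [R [yx wE]]]]] := gauss_splits gw xw.
have -> : lab x = lab y by case: yx => ->.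
have gf : gauss_word (map (relabel f) w).
  case/andP: (gw) => u /allP cl; apply/andP; split.
    rewrite -map_comp map_inj_in_uniq ?(gauss_uniq gw) // =>
      z z' zw zw' [/inj_f l p].
    exact: gauss_inj gw _ _ _ _.
  apply/allP => _ /mapP[z zw ->].
  by rewrite -[opp _]/(relabel f (opp z)) map_f // cl.
have fE : map (relabel f) w = map (relabel f) P ++
  relabel f y :: map (relabel f) Q ++ opp (relabel f y) :: map (relabel f) R.
  by rewrite wE !map_cat /= !map_cat.
rewrite -[f (lab y)]/(lab (relabel f y)) (smoothE gf fE) (smoothE gw wE).
rewrite -map_rev -!map_cat -!map_comp; apply: eq_map => z /=.
rewrite /relabel /flip /=; congr (_, _, _ (+) (_ == _)).
rewrite -map_comp !count_map; apply: eq_count => v /=;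
  by rewrite (inj_eq inj_f).
Qed.

Lemma word_polynomial_isotopic K w w' : is_diagram K w -> is_diagram K w' ->
  isotopic w w' -> word_polynomial w = word_polynomial w'.
Proof.
move=> dw dw' [f inj_f w'E]; have gw : gauss_word w by case/and3P: dw.
have iso v : isotopic (flatten_word v) (flatten_word (map (relabel f) v)).
  by exists f => //; rewrite /flatten_word -!map_comp.
have {}w'E : w' = map (relabel f) w by [].
rewrite /word_polynomial [in RHS]w'E big_map big_seq_cond [RHS]big_seq_cond.
apply: eq_bigr => x /andP[xw _].
have cw : flat_class w = flat_class w'.
  apply: flat_class_isotopic;
    [exact: flatten_diagram dw|exact: flatten_diagram dw'|].
  by rewrite w'E.
have xw' : relabel f x \in w' by rewrite w'E map_f.
have cs : flat_class (smooth (lab x) w) =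
  flat_class (smooth (lab (relabel f x)) w').
  apply: flat_class_isotopic.
  - exact: flatten_smooth_diagram dw xw.
  - exact: flatten_smooth_diagram dw' xw'.
  by rewrite w'E relabel_smooth.
by rewrite -w'E /crossing_term cs cw.
Qed.

Theorem theorem3p1 (D E : virtual_knotoid_diagram) :
  knotoid_equiv D E -> smoothing_polynomial D = smoothing_polynomial E.
Proof.
rewrite !smoothing_polynomialE.
elim=> [D' E' [iso|mv]|//|D' E' _ ->//|D' E' G _ -> _ ->//].
  exact: word_polynomial_isotopic (valP D') (valP E') iso.
exact: word_polynomial_move (valP D') (valP E') mv.
Qed.
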